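(* Let $A\to M$ be a Lie algebroid with differential $d_A$, regarded as a degree $1$ vector field on the supermanifold $[-1]A$, and let $\gamma=\exp(\iota_{d_A})$ acting on $\Omega([-1]A)$. Then the de Rham differential $d$ is $\gamma$-related to $d+\mathcal{L}_{d_A}$, i.e. $\gamma\circ d\circ\gamma^{-1}=d+\mathcal{L}_{d_A}$ as operators on $\Omega([-1]A)$.
   Context: $A\to M$ is an ordinary Lie algebroid over an ordinary manifold. $[-1]A$ is the $\mathbb{Z}$-graded supermanifold obtained by placing the fibre coordinates of $A$ in degree $1$, so $C^\infty([-1]A)=\bigwedge\Gamma(A^* )$, and $d_A$ (the Lie algebroid differential) is a homological vector field of degree $1$ on it. $\Omega([-1]A)$ is the algebra of differential forms on the supermanifold $[-1]A$: it is generated by functions and their differentials inside $C^\infty([-1]T([-1]A))$, where for a supermanifold $\mathcal{N}$ with coordinates $x^i$ the odd tangent bundle $[-1]T\mathcal{N}$ has coordinates $x^i$, $\dot x^i=dx^i$ with $|dx^i|=|x^i|+1$, and $d=\dot x^i\partial/\partial x^i$. For a vector field $X$ on $\mathcal{N}$, $\iota_X$ is the degree $|X|-1$ derivation with $\iota_Xf=0$, $\iota_X(df)=X(f)$, and $\mathcal{L}_X=[\iota_X,d]$ is the graded commutator. In particular $\iota_{d_A}$ has degree $0$ and is (locally) nilpotent on $\Omega([-1]A)$, so that $\gamma$, the generalized Mathai-Quillen-Kalkman isomorphism, is well defined. *)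

(* Defs.v *)
From HB Require Import structures.
From mathcomp Require Import all_boot all_order all_algebra.
From mathcomp Require Import all_classical all_reals all_analysis.
Import Order.TTheory GRing.Theory Num.Theory.
Import numFieldNormedType.Exports.

Set Implicit Arguments.
Unset Strict Implicit.
Unset Printing Implicit Defensive.

Local Open Scope classical_set_scope.
Local Open Scope ring_scope.

(** * Smooth manifolds *)

Section Smooth.
Context {R : realType} {n : nat}.

Fixpoint differentiable_upto (k : nat) (V : set 'rV[R]_n) (f : 'rV[R]_n -> R)
    : Prop :=
  if k is k'.+1 then
    (forall x, V x -> differentiable f x) /\
    (forall b : 'I_n, differentiable_upto k' V (fun x => 'D_(delta_mx 0 b) f x))
  else True.

(* [V] is always open below. *)
Definition smooth_fun (V : set 'rV[R]_n) (f : 'rV[R]_n -> R) : Prop :=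
  forall k, differentiable_upto k V f.

End Smooth.

(* A Hausdorff, second countable manifold of dimension [n], given by a smooth
   atlas (not necessarily maximal).  Outside [cdom i], resp. outside the image
   of the chart, the values of [cmap i], resp. [cinv i], are irrelevant. *)
Record manifold (R : realType) (n : nat) := Manifold {
  mcarrier :> topologicalType ;
  m_hausdorff : hausdorff_space mcarrier ;
  m_second_countable : @second_countable mcarrier ;
  chart : Type ;
  cdom : chart -> set mcarrier ;
  cmap : chart -> mcarrier -> 'rV[R]_n ;
  cinv : chart -> 'rV[R]_n -> mcarrier ;
  cdom_open : forall i, open (cdom i) ;
  cdom_cover : forall p, exists i, cdom i p ;
  cimg_open : forall i, open (cmap i @` cdom i) ;
  cmap_continuous : forall i, {within cdom i, continuous (cmap i)} ;
  cinv_continuous : forall i, {within cmap i @` cdom i, continuous (cinv i)} ;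
  cmapK : forall i p, cdom i p -> cinv i (cmap i p) = p ;
  ctransition : forall i j (b : 'I_n),
    smooth_fun (cmap i @` (cdom i `&` cdom j))
               (fun x => cmap j (cinv i x) 0 b)
}.

Definition smooth_on (R : realType) (n : nat) (M : manifold R n)
    (U : set M) (f : M -> R) : Prop :=
  forall i : chart M, smooth_fun (cmap i @` (cdom i `&` U)) (f \o cinv i).

Definition smooth (R : realType) (n : nat) (M : manifold R n) (f : M -> R) :=
  smooth_on [set: M] f.

(** * Vector bundles and Lie algebroids *)

(* A vector bundle of rank [r], given by its fibres and a smooth atlas of local
   trivializations. *)
Record vector_bundle (R : realType) (n : nat) (M : manifold R n) (r : nat) :=
  VectorBundle {
  fibre :> M -> lmodType R ;
  triv : Type ;
  tdom : triv -> set M ;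
  tmap : triv -> forall p, fibre p -> 'rV[R]_r ;
  tinv : triv -> forall p, 'rV[R]_r -> fibre p ;
  tdom_open : forall j, open (tdom j) ;
  tdom_cover : forall p, exists j, tdom j p ;
  tmap_linear : forall j p, tdom j p ->
    forall a (v w : fibre p), tmap j (a *: v + w) = a *: tmap j v + tmap j w ;
  tmapK : forall j p, tdom j p -> forall v : fibre p, tinv j p (tmap j v) = v ;
  tinvK : forall j p, tdom j p -> forall x, tmap j (tinv j p x) = x ;
  ttransition : forall j k (a b : 'I_r),
    smooth_on (tdom j `&` tdom k)
              (fun p => tmap k (tinv j p (delta_mx 0 a)) 0 b)
}.

Section Sections.
Context {R : realType} {n : nat} {M : manifold R n} {r : nat}.
Variable E : vector_bundle M r.

Definition frame (j : triv E) (p : M) (a : 'I_r) : E p :=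
  tinv j p (delta_mx 0 a).

(* Sections are arbitrary; smoothness is a separate predicate. *)
Definition section_of := forall p : M, E p.

Definition smooth_section (s : section_of) : Prop :=
  forall (j : triv E) (a : 'I_r),
    smooth_on (tdom j) (fun p => tmap j (s p) 0 a).

End Sections.

(* Tangent vectors at [p] are the point derivations of C^oo(M). *)
Definition tangent_vector (R : realType) (n : nat) (M : manifold R n) (p : M)
    (D : (M -> R) -> R) : Prop :=
  (forall a f g, smooth f -> smooth g ->
     D (fun q => a * f q + g q) = a * D f + D g) /\
  (forall f g, smooth f -> smooth g ->
     D (fun q => f q * g q) = f p * D g + D f * g p).

(* [bracket] and [anchor] only matter on smooth sections and functions. *)
Record lie_algebroid (R : realType) (n : nat) (M : manifold R n) (r : nat)
    (E : vector_bundle M r) := LieAlgebroid {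
  bracket : section_of E -> section_of E -> section_of E ;
  anchor : forall p : M, E p -> (M -> R) -> R ;
  anchor_tangent : forall p (v : E p), tangent_vector p (anchor v) ;
  anchor_linear : forall p a (v w : E p) f, smooth f ->
    anchor (a *: v + w) f = a * anchor v f + anchor w f ;
  anchor_smooth : forall s f, smooth_section s -> smooth f ->
    smooth (fun p => anchor (s p) f) ;
  bracket_smooth : forall s t,
    smooth_section s -> smooth_section t -> smooth_section (bracket s t) ;
  bracket_linear : forall a s t u,
    smooth_section s -> smooth_section t -> smooth_section u ->
    forall p, bracket (fun q => a *: s q + t q) u p
              = a *: bracket s u p + bracket t u p ;
  bracket_antisym : forall s t, smooth_section s -> smooth_section t ->
    forall p, bracket s t p = - bracket t s p ;
  bracket_jacobi : forall s t u,
    smooth_section s -> smooth_section t -> smooth_section u ->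
    forall p, bracket s (bracket t u) p + bracket t (bracket u s) p
              + bracket u (bracket s t) p = 0 ;
  bracket_leibniz : forall s t f,
    smooth_section s -> smooth_section t -> smooth f ->
    forall p, bracket s (fun q => f q *: t q) p
              = f p *: bracket s t p + anchor (s p) f *: t p ;
  anchor_bracket : forall s t f,
    smooth_section s -> smooth_section t -> smooth f ->
    forall p, anchor (bracket s t p) f
              = anchor (s p) (fun q => anchor (t q) f)
                - anchor (t p) (fun q => anchor (s q) f)
}.

(** * Functions on [-1]A and the Lie algebroid differential *)

Section Superfunctions.
Context {R : realType} {n : nat} {M : manifold R n} {r : nat}.
Variable E : vector_bundle M r.

(* An element [f] of C^oo([-1]A) = /\ Gamma(A^* ): its component of degree [k],
   a smooth section of /\^k A^*, is [f] on the lists of [k] vectors of a fibre.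
   An alternating form of degree greater than [r] vanishes. *)
Definition superfun := forall p : M, seq (E p) -> R.

Record is_superfun (f : superfun) : Prop := IsSuperfun {
  superfun_linear : forall p (us ws : seq (E p)) a x y,
    f p (us ++ (a *: x + y) :: ws)
      = a * f p (us ++ x :: ws) + f p (us ++ y :: ws) ;
  superfun_alternating : forall p (us vs ws : seq (E p)) x,
    f p (us ++ x :: vs ++ x :: ws) = 0 ;
  superfun_smooth : forall (j : triv E) (s : seq 'I_r),
    smooth_on (tdom j) (fun p => f p [seq frame j p a | a <- s])
}.

Definition omit (T : Type) (i : nat) (s : seq T) := take i s ++ drop i.+1 s.

Definition at_point (p : M) (ss : seq (section_of E)) : seq (E p) :=
  [seq s p | s : section_of E <- ss].

Definition koszul (A : lie_algebroid E) (f : superfun)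
    (ss : seq (section_of E)) (p : M) : R :=
  let s i := nth (fun q => 0) ss i in
  \sum_(i < size ss)
     (-1) ^+ i * anchor A (s i p) (fun q => f q (at_point q (omit i ss)))
  + \sum_(i < size ss) \sum_(j < size ss | (i < j)%N)
     (-1) ^+ (i + j) *
       f p (bracket A (s i) (s j) p :: at_point p (omit i (omit j ss))).

(* Every vector extends to a smooth section, so this determines [dA]. *)
Definition algebroid_differential (A : lie_algebroid E)
    (dA : superfun -> superfun) : Prop :=
  forall f, is_superfun f ->
    is_superfun (dA f) /\
    forall (ss : seq (section_of E)) (p : M),
      (forall i, (i < size ss)%N -> smooth_section (nth (fun q => 0) ss i)) ->
      dA f p (at_point p ss) = koszul A f ss p.

(** * Differential forms on [-1]A *)

(* A chart of M with coordinates x^b and a local frame of A, with dual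
   coordinates xi^a of degree 1, give coordinates x^b, xi^a, dx^b, dxi^a of
   degrees 0, 1, 1, 2 on [-1]T([-1]A).  A function on [-1]T([-1]A) is described
   by its expansions in all these coordinate systems:  [w i j S m] is the
   coefficient of the monomial  e_S * \prod_a (dxi^a)^(m a), where e_S is the
   increasing product of the odd coordinates indexed by S; the coordinate xi^a
   has index [lshift n a], the coordinate dx^b has index [rshift r b].
   Coefficients are functions on [M], extended by 0 outside the domain of the
   coordinate system. *)
Definition diff_form : Type :=
  chart M -> triv E -> {set 'I_(r + n)} -> {ffun 'I_r -> nat} -> M -> R.

Definition coord_dom (i : chart M) (j : triv E) : set M := cdom i `&` tdom j.

(* e_T e_T' = (-1)^(inversions T T') e_(T u T') for disjoint T and T'. *)
Definition inversions (T T' : {set 'I_(r + n)}) : nat :=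
  #|[pred bc : 'I_(r + n) * 'I_(r + n) |
      [&& bc.1 \in T, bc.2 \in T' & (bc.2 < bc.1)%N]]|.

Definition form_mul (w w' : diff_form) : diff_form := fun i j S m p =>
  \sum_(T : {set 'I_(r + n)} | T \subset S)
   \sum_(m1 : {dffun forall a : 'I_r, 'I_(m a).+1})
     (-1) ^+ inversions T (S :\: T)
     * w i j T [ffun a => nat_of_ord (m1 a)] p
     * w' i j (S :\: T) [ffun a => (m a - m1 a)%N] p.

Definition form_of_superfun (f : superfun) : diff_form := fun i j S m =>
  (fun p => if [forall b, rshift r b \notin S] && (m == [ffun=> 0%N])
            then f p [seq frame j p a | a <- enum 'I_r & lshift n a \in S]
            else 0) \_ (coord_dom i j).

Definition coord_dx (b : 'I_n) : diff_form := fun i j S m p =>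
  ((S == finset.set1 (rshift r b)) && (m == [ffun=> 0%N]))%:R.

Definition coord_dxi (a : 'I_r) : diff_form := fun i j S m p =>
  ((S == finset.set0) && (m == [ffun a' => nat_of_bool (a' == a)]))%:R.

Definition partial_x (b : 'I_n) (w : diff_form) : diff_form := fun i j S m =>
  (fun p => 'D_(delta_mx 0 b) (fun x => w i j S m (cinv i x)) (cmap i p))
    \_ (coord_dom i j).

(* Left derivative. *)
Definition partial_xi (a : 'I_r) (w : diff_form) : diff_form :=
  fun i j S m p =>
  if lshift n a \in S then 0
  else (-1) ^+ inversions (finset.set1 (lshift n a)) S
       * w i j (finset.setU (finset.set1 (lshift n a)) S) m p.

Definition deRham (w : diff_form) : diff_form :=
  \sum_(b < n) form_mul (coord_dx b) (partial_x b w)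
  + \sum_(a < r) form_mul (coord_dxi a) (partial_xi a w).

(* Omega([-1]A), the algebra generated by functions and their differentials.
   Real constants are functions, so this is a subspace.  The generators are
   globally defined on [-1]T([-1]A) and polynomial in the dxi^a, hence so are
   all elements: their expansions agree under changes of coordinates. *)
Inductive Omega : diff_form -> Prop :=
| Omega_fun f : is_superfun f -> Omega (form_of_superfun f)
| Omega_diff f : is_superfun f -> Omega (deRham (form_of_superfun f))
| Omega_add w w' : Omega w -> Omega w' -> Omega (w + w')
| Omega_mul w w' : Omega w -> Omega w' -> Omega (form_mul w w').

Definition homogeneous (k : int) (w : diff_form) : Prop :=
  forall i j S m p,
    w i j S m p <> 0 -> (#|S| + 2 * \sum_(a < r) m a)%N%:Z = k.

Record graded_derivation (k : int) (D : diff_form -> diff_form) : Prop := {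
  derivation_Omega : forall w, Omega w -> Omega (D w) ;
  derivation_linear : forall (a : R) w w', Omega w -> Omega w' ->
    D (a *: w + w') = a *: D w + D w' ;
  derivation_degree : forall l w, Omega w ->
    homogeneous l w -> homogeneous (l + k) (D w) ;
  derivation_leibniz : forall l w w', Omega w -> Omega w' ->
    homogeneous l w ->
    D (form_mul w w')
      = form_mul (D w) w' + ((-1) ^ (k * l) : R) *: form_mul w (D w')
}.

(* [iota] is the interior product with the vector field [X] of degree [k].  As Omega is
   generated by functions and their differentials, this determines [iota]. *)
Definition interior_product (k : int) (X : superfun -> superfun)
    (iota : diff_form -> diff_form) : Prop :=
  graded_derivation (k - 1) iota /\
  forall f, is_superfun f ->
    iota (form_of_superfun f) = 0 /\
    iota (deRham (form_of_superfun f)) = form_of_superfun (X f).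

(* The graded commutator of [iota], of degree [k - 1], and [deRham]. *)
Definition lie_derivative (k : int) (iota : diff_form -> diff_form)
    (w : diff_form) : diff_form :=
  iota (deRham w) - ((-1) ^ (k - 1) : R) *: deRham (iota w).

(* exp(D) w, for [D] linear and nilpotent on [w]: the truncation does not
   depend on the choice of an exponent killing [w]. *)
Definition exp_op (D : diff_form -> diff_form) (w : diff_form) : diff_form :=
  \sum_(k < xget 0%N [set N | iter N D w = 0]) (k`!%:R : R)^-1 *: iter k D w.

End Superfunctions.

(* Main.v *)
Require Import Defs.
From HB Require Import structures.
From mathcomp Require Import all_boot all_order all_algebra.
From mathcomp Require Import all_classical all_reals all_analysis.
From mathcomp Require Import ring lra zify.
Import Order.TTheory GRing.Theory Num.Theory.
Import numFieldNormedType.Exports.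

(** Conjugating [d] by [exp iota] gives
      [d + [iota, d] + (1/2) [iota, [iota, d]] + ...],
    whose second term is the Lie derivative.  The theorem therefore says that
    [[iota, [iota, d]] = 0].  This operator is an odd derivation of Omega
    ([comm_iota_odd], used twice), so it vanishes as soon as it kills the
    generators ([comm_iota_lie]).  On a function [f] it is
    [iota (iota (d f)) = iota (d_A f) = 0], and on a differential [d f] it is
    [- 2 iota (d (d_A f)) = - 2 d_A (d_A f)], which is zero because the Lie
    algebroid differential squares to zero.  The same generators show that
    [iota] is locally nilpotent ([nilpotent_mul]).

    Three facts about the concrete operators feed this argument.

    - [d_A] squares to zero ([dA_dA_frame]).  The Koszul formula is rewritten as
      the recursion [i_x d = L_x - d i_x] on cochains ([koszul_ce_diff]); the
      Cartan relations then hold by definition or by induction on the number of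
      arguments, and give [d d = 0] in the same way ([ce_diff_ce_diff]).  The
      Koszul formula only speaks of global sections, so the vectors of a local
      frame are first extended by means of a bump function
      ([frame_extension]).

    - [d] squares to zero and is an odd derivation ([deRham_deRham],
      [deRham_mul]).  In coordinates, [d] is the sum of the operators
      multiplication by [dx] after [d/dx] and multiplication by [dxi] after
      [d/dxi].  Multiplications and partial derivatives commute or anticommute
      among themselves; for [d/dx] this is the symmetry of second derivatives
      ([derive_comm]).

    - Every element of Omega is a finite sum of homogeneous ones built from
      homogeneous functions ([Omega_graded_span]), so the Leibniz rules, which
      carry signs, can be used for all of Omega.

    Once [[iota, [iota, d]] = 0], an induction gives
    [iota^k d = d iota^k + k L iota^(k-1)], hence
    [exp(iota) d = (d + L) exp(iota)] ([expo_d]).  Finally [exp iota] is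
    unipotent, so it is bijective on Omega ([expo_inj], [expo_surj]). *)

Set Implicit Arguments.
Unset Strict Implicit.
Unset Printing Implicit Defensive.

Local Open Scope ring_scope.

(** * Calculus of smooth functions on open sets *)

Section NearDifferentiable.
Local Open Scope classical_set_scope.
Local Open Scope ring_scope.
Context {R : realType} {V W : normedModType R}.

Lemma differentiable_near0 (e : V -> W) (x : V) :
  (\forall y \near x, e y = 0) -> differentiable e x.
Proof.
move=> e0; have ex0 : e x = 0 by exact: nbhs_singleton e0.
have E : e \o shift x = cst (e x) + \0 +o_ 0 id.
  apply/eqaddoP => _/posnumP[eps].
  have : \forall h \near (0 : V), e (h + x) = 0.
    by have := e0; rewrite (near_shift 0) subr0.
  move=> e0'; near=> h; rewrite [_ h](_ : _ = 0) ?normr0 ?mulr_ge0//.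
  rewrite /= !fctE/= ex0 /cst /= addr0 subr0.
  by near: h.
have d0 : 'd e x = \0 :> (V -> W) by apply: diff_unique => //; exact: cst_continuous.
by apply/diff_locallyP; rewrite d0; split=> //; exact: cst_continuous.
Unshelve. all: by end_near. Qed.

Lemma near_eq_differentiable (f g : V -> W) (x : V) :
  (\forall y \near x, f y = g y) -> differentiable f x -> differentiable g x.
Proof.
move=> fg df; have -> : g = f + (g - f) by rewrite addrC subrK.
apply: differentiableD => //; apply: differentiable_near0.
by near=> y; rewrite !fctE (near fg y)// subrr.
Unshelve. all: by end_near. Qed.

End NearDifferentiable.

Section SmoothCalculus.
Local Open Scope classical_set_scope.
Local Open Scope ring_scope.
Context {R : realType} {n : nat}.
Implicit Types (V W : set 'rV[R]_n) (f g : 'rV[R]_n -> R) (k : nat).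

Lemma differentiable_upto_sub k V W f :
  W `<=` V -> differentiable_upto k V f -> differentiable_upto k W f.
Proof.
elim: k f => //= k IH f WV [df ddf]; split=> [x /WV|b]; first exact: df.
exact: IH.
Qed.

(** Differentiability at [x] is a property of the germ at [x], and the
    successive derivatives are total functions that do not depend on the open
    set, so smoothness may be checked on the members of a cover. *)
Lemma differentiable_upto_local k V f :
  (forall x, V x -> exists W, W x /\ differentiable_upto k W f) ->
  differentiable_upto k V f.
Proof.
elim: k f => //= k IH f H; split=> [x /H[W [Wx [dW _]]]|b]; first exact: dW.
by apply: IH => x /H[W [Wx [_ dW]]]; exists W.
Qed.

Lemma differentiable_upto_eq k V f g : open V ->
  (forall x, V x -> f x = g x) ->
  differentiable_upto k V f -> differentiable_upto k V g.
Proof.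
move=> oV; elim: k f g => //= k IH f g fg [df ddf].
have nfg x : V x -> \forall y \near x, f y = g y.
  by move=> Vx; near=> y; apply: fg; near: y; exact: open_nbhs_nbhs.
split=> [x Vx|b]; first exact: near_eq_differentiable (nfg x Vx) (df x Vx).
by apply: IH (ddf b) => x Vx; apply: near_eq_derive; exact: nfg.
Unshelve. all: by end_near. Qed.

Lemma differentiable_uptoW k V f :
  differentiable_upto k.+1 V f -> differentiable_upto k V f.
Proof.
elim: k f => // k IH f [df ddf]; split=> // b; exact: IH (ddf b).
Qed.

Lemma differentiable_upto_cst k V (c : R) : differentiable_upto k V (cst c).
Proof.
elim: k c => //= k IH c; split=> // b.
rewrite (_ : (fun _ => _) = cst 0); first exact: IH.
by apply/funext => x; rewrite derive_cst.
Qed.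

Lemma differentiable_uptoD k V f g : open V ->
  differentiable_upto k V f -> differentiable_upto k V g ->
  differentiable_upto k V (fun x => f x + g x).
Proof.
move=> oV; elim: k f g => //= k IH f g [df ddf] [dg ddg].
split=> [x Vx|b]; first by apply: differentiableD; [exact: df|exact: dg].
apply: differentiable_upto_eq (IH _ _ (ddf b) (ddg b)) => // x Vx.
by rewrite -[RHS]/('D__ (f + g) x) deriveD//; apply: diff_derivable; [exact: df|exact: dg].
Qed.

Lemma differentiable_uptoM k V f g : open V ->
  differentiable_upto k V f -> differentiable_upto k V g ->
  differentiable_upto k V (fun x => f x * g x).
Proof.
move=> oV; elim: k f g => //= k IH f g Hf Hg.
have [df ddf] := Hf; have [dg ddg] := Hg.
split=> [x Vx|b]; first by apply: differentiableM; [exact: df|exact: dg].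
apply: (@differentiable_upto_eq _ _ (fun x => f x * 'D_(delta_mx 0 b) g x
  + g x * 'D_(delta_mx 0 b) f x)) => // [x Vx|].
  rewrite -[RHS]/('D__ (f * g) x) deriveM//; apply: diff_derivable; [exact: df|exact: dg].
apply: differentiable_uptoD => //; apply: IH => //; exact: differentiable_uptoW.
Qed.

Lemma smooth_funS V W f : W `<=` V -> smooth_fun V f -> smooth_fun W f.
Proof. by move=> WV sf k; exact: differentiable_upto_sub WV (sf k). Qed.

Lemma smooth_fun_local V f :
  (forall x, V x -> exists W, W x /\ smooth_fun W f) -> smooth_fun V f.
Proof.
move=> H k; apply: differentiable_upto_local => x /H[W [Wx sW]].
by exists W; split.
Qed.

Lemma smooth_fun_eq V f g : open V ->
  (forall x, V x -> f x = g x) -> smooth_fun V f -> smooth_fun V g.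
Proof. by move=> oV fg sf k; exact: differentiable_upto_eq (sf k). Qed.

Lemma smooth_fun_cst V (c : R) : smooth_fun V (fun=> c).
Proof. by move=> k; exact: differentiable_upto_cst. Qed.

Lemma smooth_funD V f g : open V ->
  smooth_fun V f -> smooth_fun V g -> smooth_fun V (fun x => f x + g x).
Proof. by move=> oV sf sg k; exact: differentiable_uptoD. Qed.

Lemma smooth_funM V f g : open V ->
  smooth_fun V f -> smooth_fun V g -> smooth_fun V (fun x => f x * g x).
Proof. by move=> oV sf sg k; exact: differentiable_uptoM. Qed.

Lemma smooth_funZ V (c : R) f : open V ->
  smooth_fun V f -> smooth_fun V (fun x => c * f x).
Proof. by move=> oV; apply: smooth_funM => //; exact: smooth_fun_cst. Qed.

Lemma smooth_fun_sum V (I : Type) (s : seq I) (P : pred I) (F : I -> 'rV[R]_n -> R) :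
  open V -> (forall i, P i -> smooth_fun V (F i)) ->
  smooth_fun V (fun x => \sum_(i <- s | P i) F i x).
Proof.
move=> oV sF; elim: s => [|i s IH].
  by apply: smooth_fun_eq (smooth_fun_cst V 0) => // x _; rewrite big_nil.
have [Pi|/negPf Pi] := boolP (P i); last first.
  by apply: smooth_fun_eq IH => // x _; rewrite big_cons Pi.
apply: smooth_fun_eq (smooth_funD oV (sF i Pi) IH) => // x _.
by rewrite big_cons Pi.
Qed.

Lemma smooth_fun_prod V (I : Type) (s : seq I) (F : I -> 'rV[R]_n -> R) :
  open V -> (forall i, smooth_fun V (F i)) ->
  smooth_fun V (fun x => \prod_(i <- s) F i x).
Proof.
move=> oV sF; elim: s => [|i s IH].
  by apply: smooth_fun_eq (smooth_fun_cst V 1) => // x _; rewrite big_nil.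
by apply: smooth_fun_eq (smooth_funM oV (sF i) IH) => // x _; rewrite big_cons.
Qed.

Lemma smooth_fun_derivable V f x (v : 'rV[R]_n) :
  smooth_fun V f -> V x -> derivable f x v.
Proof. by move=> sf Vx; apply: diff_derivable; case: (sf 1%N) => df _; exact: df. Qed.

Lemma smooth_fun_derive V f (b : 'I_n) :
  smooth_fun V f -> smooth_fun V (fun x => 'D_(delta_mx 0 b) f x).
Proof. by move=> sf k; case: (sf k.+1) => _; exact. Qed.

(** Only functions of one variable need to be composed with smooth functions.
    By the chain rule the derivative of [phi (f x)] is [phi' (f x)] times a
    derivative of [f]; stating the lemma for a class closed under derivation
    makes the induction on the order go through without naming the iterated
    derivatives of [phi]. *)
Lemma smooth_fun_comp V (Phi : set (R -> R)) f (phi : R -> R) : open V ->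
  (forall u, Phi u -> exists2 u', Phi u' & forall t : R, is_derive t (1 : R) u (u' t)) ->
  Phi phi -> smooth_fun V f -> smooth_fun V (fun x => phi (f x)).
Proof.
move=> oV dPhi + sf k; elim: k phi => //= k IH u Pu.
have [u' Pu' du] := dPhi u Pu.
have du_ (t : R) : differentiable u t by apply/derivable1_diffP; case: (du t).
have df x : V x -> differentiable f x by case: (sf 1%N) => + _; exact.
split=> [x Vx|b]; first by apply: differentiable_comp => //; exact: df.
apply: (@differentiable_upto_eq _ _ (fun x => u' (f x) * 'D_(delta_mx 0 b) f x)) => //.
  move=> x Vx; rewrite -[RHS]/('D__ (u \o f) x).
  have dfx := df x Vx.
  have dufx : differentiable (u \o f) x by exact: differentiable_comp.
  rewrite (deriveE _ dufx) (deriveE _ dfx).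
  rewrite (diff_comp dfx (du_ (f x)) : _ = _ :> (_ -> _)) /= diff1E// derive1E.
  by rewrite derive_val mulrC.
apply: differentiable_uptoM => //; first exact: IH.
exact: smooth_fun_derive.
Qed.

End SmoothCalculus.

(** * Symmetry of second derivatives *)

Section Schwarz.
Local Open Scope classical_set_scope.
Local Open Scope ring_scope.
Context {R : realType} {V : normedModType R}.

Lemma is_derive_line (f : V -> R) (x u : V) (t : R) :
  derivable f (x + t *: u) u ->
  is_derive t (1 : R) (fun s : R => f (x + s *: u)) ('D_u f (x + t *: u)).
Proof.
have E (h : R) : f (x + (h *: (1 : R) + t) *: u) = f (h *: u + (x + t *: u)).
  by rewrite addrCA scalerDl /GRing.scale/= mulr1.
have E' : (fun h : R => h^-1 *: (((fun s : R => f (x + s *: u)) \o shift t) (h *: (1 : R))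
      - f (x + t *: u))) =
   (fun h : R => h^-1 *: ((f \o shift (x + t *: u)) (h *: u) - f (x + t *: u))).
  by apply/funext => h /=; rewrite E.
by move=> df; split; rewrite /derivable /derive E'.
Qed.

Lemma MVT_line (f : V -> R) (x u : V) (h : R) : 0 < h ->
  (forall t, t \in `[0, h] -> derivable f (x + t *: u) u) ->
  exists2 c, c \in `]0, h[ & f (x + h *: u) - f x = h * 'D_u f (x + c *: u).
Proof.
move=> h0 df.
pose F (s : R) : R := f (x + s *: u); pose dF (s : R) : R := 'D_u f (x + s *: u).
have FdF (t : R) : t \in `[0, h] -> is_derive t (1 : R) F (dF t).
  by move=> /df /is_derive_line.
have FdFo (t : R) : t \in `]0, h[%R -> is_derive t (1 : R) F (dF t).
  by move=> th; apply: FdF; exact: subset_itv_oo_cc th.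
have cF : {within [set` `[0, h]%R], continuous F}.
  by apply: derivable_within_continuous => t /FdF [].
have [c ch E] := MVT h0 FdFo cF.
by exists c => //; move: E; rewrite /F subr0 scale0r addr0 mulrC.
Qed.

(** The mean value theorem along [u], then along [v].  The left-hand side is
    symmetric in [u] and [v], which is what makes the mixed derivatives
    comparable. *)
Lemma second_difference (f : V -> R) (x u v : V) (h : R) : 0 < h ->
  (forall s t, s \in `[0, h] -> t \in `[0, h] ->
    derivable f (x + s *: u + t *: v) u /\
    derivable ('D_u f) (x + s *: u + t *: v) v) ->
  exists s t, [/\ s \in `]0, h[, t \in `]0, h[ &
    f (x + h *: u + h *: v) - f (x + h *: u) - f (x + h *: v) + f x
    = h * h * 'D_v ('D_u f) (x + s *: u + t *: v)].
Proof.
move=> h0 df.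
have h_in : h \in `[0, h] by rewrite in_itv/= lexx ltW.
have z_in : 0 \in `[0, h] by rewrite in_itv/= lexx ltW.
pose g y := f (y + h *: v) - f y.
have dshift (y : V) : derivable f (y + h *: v) u ->
   is_derive y u (fun z => f (z + h *: v)) ('D_u f (y + h *: v)).
  have E : (fun k : R => k^-1 *: (((fun z : V => f (z + h *: v)) \o shift y) (k *: u)
      - f (y + h *: v))) =
   (fun k : R => k^-1 *: ((f \o shift (y + h *: v)) (k *: u) - f (y + h *: v))).
    by apply/funext => k /=; rewrite addrA.
  by move=> d; split; rewrite /derivable /derive E.
have dg s : s \in `[0, h] -> is_derive (x + s *: u) u g
    ('D_u f (x + s *: u + h *: v) - 'D_u f (x + s *: u)).
  move=> sh; apply: is_deriveB; first by apply: dshift; case: (df s h sh h_in).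
  by case: (df s 0 sh z_in); rewrite scale0r addr0 => /derivableP.
have [s sh Es] := MVT_line h0 (fun s sh => @ex_derive _ _ _ _ _ _ _ (dg s sh)).
have sh' : s \in `[0, h] by exact: subset_itv_oo_cc sh.
have [t th Et] := @MVT_line ('D_u f) (x + s *: u) v h h0
   (fun t th => (df s t sh' th).2).
exists s, t; split=> //.
have -> : f (x + h *: u + h *: v) - f (x + h *: u) - f (x + h *: v) + f x =
  g (x + h *: u) - g x by rewrite /g; ring.
rewrite Es (@derive_val _ _ _ _ _ _ _ (dg s sh')) Et mulrA //.
Qed.

(** Applying [second_difference] in both orders gives points arbitrarily close
    to [x] at which the two mixed derivatives agree; continuity concludes. *)
Lemma derive_comm (f : V -> R) (D : set V) (x u v : V) : open D -> D x ->
  (forall y, D y -> [/\ derivable f y u, derivable f y v,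
     derivable ('D_u f) y v & derivable ('D_v f) y u]) ->
  {for x, continuous ('D_v ('D_u f))} -> {for x, continuous ('D_u ('D_v f))} ->
  'D_v ('D_u f) x = 'D_u ('D_v f) x.
Proof.
move=> oD Dx df cuv cvu; apply/eqP; rewrite -subr_eq0 -normr_le0.
apply/ler_addgt0Pl => e e0; rewrite addr0.
have e20 : 0 < e / 2 by rewrite divr_gt0.
have : \forall y \near x, [/\ D y, `|'D_v ('D_u f) x - 'D_v ('D_u f) y| < e / 2 &
    `|'D_u ('D_v f) x - 'D_u ('D_v f) y| < e / 2].
  have nD : nbhs x D by exact: open_nbhs_nbhs.
  have nuv : \forall y \near x, `|'D_v ('D_u f) x - 'D_v ('D_u f) y| < e / 2.
    by move/cvgrPdist_lt : cuv => /(_ _ e20).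
  have nvu : \forall y \near x, `|'D_u ('D_v f) x - 'D_u ('D_v f) y| < e / 2.
    by move/cvgrPdist_lt : cvu => /(_ _ e20).
  by apply: filterS3 nD nuv nvu => y.
move=> /nbhs_normP[d /= d0 H].
(* small enough for the square of side [h] to lie in the ball of radius [d] *)
pose h := d / (`|u| + `|v| + 1).
have N0 : 0 < `|u| + `|v| + 1 by rewrite ltr_wpDl// addr_ge0.
have h0 : 0 < h by rewrite divr_gt0.
have B s t : s \in `[0, h] -> t \in `[0, h] ->
   [/\ D (x + s *: u + t *: v), `|'D_v ('D_u f) x - 'D_v ('D_u f) (x + s *: u + t *: v)| < e / 2 &
    `|'D_u ('D_v f) x - 'D_u ('D_v f) (x + s *: u + t *: v)| < e / 2].
  rewrite !in_itv/= => /andP[s0 sh] /andP[t0 th].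
  apply: H; rewrite /= -addrA opprD addrA subrr add0r normrN.
  apply: le_lt_trans (ler_normD _ _) _; rewrite !normrZ !ger0_norm//.
  apply: (@le_lt_trans _ _ (h * `|u| + h * `|v|)).
    by apply: lerD; apply: ler_wpM2r.
  rewrite -mulrDr /h mulrAC ltr_pdivrMr// ltr_pM2l// ltrDl//.
have [s [t [sh th E1]]] := @second_difference f x u v h h0
   (fun s t sh th => let: And3 Dy _ _ := B s t sh th in
       let: And4 a b c d := df _ Dy in conj a c).
have [s' [t' [sh' th' E2]]] := @second_difference f x v u h h0
   (fun s t sh th => let: And3 Dy _ _ := B t s th sh in
       let: And4 a b c d := df _ (eq_ind _ D Dy _ (addrAC _ _ _)) in conj b d).
have [_ B1 _] := B s t (subset_itv_oo_cc sh) (subset_itv_oo_cc th).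
have [_ _ B2] := B t' s' (subset_itv_oo_cc th') (subset_itv_oo_cc sh').
have E3 : 'D_v ('D_u f) (x + s *: u + t *: v) = 'D_u ('D_v f) (x + t' *: u + s' *: v).
  apply: (@mulfI _ (h * h)); first by rewrite mulf_neq0// gt_eqF.
  apply: etrans (esym E1) _; rewrite (addrAC x (t' *: u)).
  apply: etrans E2; rewrite (addrAC x (h *: v)); congr (_ + _).
  exact: addrAC.
rewrite E3 in B1.
rewrite -(subrK ('D_u ('D_v f) (x + t' *: u + s' *: v)) ('D_v ('D_u f) x)) -addrA.
apply: le_trans (ler_normD _ _) _.
rewrite [e]splitr; apply: lerD; first exact: ltW B1.
rewrite distrC; exact: ltW B2.
Unshelve. all: by end_near. Qed.

End Schwarz.

Section SmoothSchwarz.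
Local Open Scope classical_set_scope.
Local Open Scope ring_scope.

Lemma smooth_fun_derive_comm {R : realType} {n : nat} (V : set 'rV[R]_n)
  (f : 'rV[R]_n -> R) (a b : 'I_n) x : open V -> smooth_fun V f -> V x ->
  'D_(delta_mx 0 a) ('D_(delta_mx 0 b) f) x = 'D_(delta_mx 0 b) ('D_(delta_mx 0 a) f) x.
Proof.
move=> oV sf Vx.
have sd c : smooth_fun V ('D_(delta_mx 0 c) f) by exact: smooth_fun_derive.
have sdd c c' : smooth_fun V ('D_(delta_mx 0 c') ('D_(delta_mx 0 c) f)).
  exact: smooth_fun_derive.
apply: (derive_comm oV Vx) => [y Vy||].
- by split; apply: smooth_fun_derivable => //.
- by apply: differentiable_continuous; case: (sdd b a 1%N) => + _; exact.
- by apply: differentiable_continuous; case: (sdd a b 1%N) => + _; exact.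
Qed.

End SmoothSchwarz.

(** * A smooth function that vanishes on a half-line *)

Section Flat.
Local Open Scope classical_set_scope.
Local Open Scope ring_scope.
Context {R : realType}.
Implicit Types (P Q : {poly R}) (t : R).

(** For [P = 1] this is the classical function [exp(-1/t)] extended by zero.
    The polynomial factor in [1/t] makes the family closed under derivation. *)
Definition flat P (t : R) : R :=
  if 0 < t then P.[t^-1] * expR (- t^-1) else 0.

Lemma flat_le0 P t : t <= 0 -> flat P t = 0.
Proof. by rewrite /flat ltNge => ->. Qed.

(** Each monomial [t^(-i)] is beaten by [exp(1/t) >= t^(-i-1) / (i+1)!]. *)
Lemma flat_bound P : exists2 C, 0 <= C & forall t, 0 < t -> `|flat P t| <= C * t.
Proof.
elim/poly_ind: P => [|P c _]; last move: (P * 'X + c%:P) => {c}P.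
  by exists 0 => // t t0; rewrite /flat t0 horner0 !mul0r normr0.
exists (\sum_(i < size P) `|P`_i| * i.+1`!%:R) => [|t t0].
  by apply: sumr_ge0 => i _; rewrite mulr_ge0.
rewrite /flat t0 horner_coef mulr_suml mulr_suml.
apply: le_trans (ler_norm_sum _ _ _) _; apply: ler_sum => i _.
rewrite !normrM -!mulrA ler_wpM2l//.
set u := t^-1; have u0 : 0 < u by rewrite invr_gt0.
rewrite normrX gtr0_norm// gtr0_norm ?expR_gt0// expRN.
rewrite ler_pdivrMr ?expR_gt0//.
have H := expR_ge1Dxn i (ltW u0).
have -> : u ^+ i = i.+1`!%:R * t * (u ^+ i.+1 / i.+1`!%:R).
  have f0 : i.+1`!%:R != 0 :> R by rewrite pnatr_eq0 -lt0n fact_gt0.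
  by rewrite exprS /u; field; rewrite f0 gt_eqF.
rewrite ler_wpM2l ?mulr_ge0 ?(ltW t0)//.
by apply: le_trans H; rewrite lerDr.
Qed.

(** Away from [0] this is the usual computation.  At [0] the difference quotient
    of [flat P] is [flat (P * 'X)], which tends to [0] by [flat_bound]. *)
Lemma is_derive_flat P t : is_derive t (1 : R) (flat P) (flat ((P - P^`()) * 'X^2) t).
Proof.
have [t0|t0|->] := ltgtP t 0.
- rewrite flat_le0 ?ltW//.
  apply: (@near_eq_is_derive _ _ _ (cst 0)) => //.
  near=> s; rewrite flat_le0// ltW//; near: s; exact: lt_nbhsl.
- have tn0 : t != 0 by rewrite gt_eqF.
  apply: (@near_eq_is_derive R R R (fun s : R => P.[s^-1] * expR (- s^-1))).
    by near=> s; rewrite /flat ifT//; near: s; exact: lt_nbhsr.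
  have dV : is_derive t (1 : R) (fun s : R => s^-1) (- t ^- 2).
    have := @is_deriveV R id t 1 1 tn0 (is_derive_id _ _).
    by rewrite /GRing.scale/= mulr1.
  have dP : is_derive t (1 : R) (fun s : R => P.[s^-1]) (P^`().[t^-1] * (- t ^- 2)).
    exact: (@is_derive1_comp R (horner P) (fun s => s^-1)).
  have dE : is_derive t (1 : R) (fun s : R => expR (- s^-1)) (expR (- t^-1) * (t ^- 2)).
    apply: (@is_derive1_comp R expR (fun s => - s^-1)).
    by apply: is_derive_eq; rewrite opprK.
  apply: (@is_derive_eq _ _ _ _ _ _ _ _ (is_deriveM dP dE)).
  rewrite /flat t0 /GRing.scale/= hornerM hornerD hornerN hornerXn exprVn.
  move: (P.[_]) (P^`().[_]) (expR _) (t ^- 2) => a b c d. ring.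
- rewrite flat_le0//.
  have [C C0 HC] := flat_bound (P * 'X).
  have C1 : 0 < C + 1 by rewrite ltr_wpDl.
  have cv : (fun h : R => h^-1 *: ((flat P \o shift 0) (h *: (1 : R)) - flat P 0)) h @[h --> 0^'] --> (0 : R).
    apply/cvgrPdist_le => e e0.
    near=> h; rewrite sub0r normrN /= (flat_le0 P (lexx 0)) subr0 addr0.
    rewrite /GRing.scale/= mulr1; have [h0|h0] := leP h 0.
      by rewrite flat_le0// mulr0 normr0 ltW.
    rewrite (_ : _ * _ = flat (P * 'X) h); last first.
      by rewrite /flat h0 hornerM hornerX; ring.
    apply: le_trans (HC _ h0) _.
    apply: (@le_trans _ _ ((C + 1) * h)); first by rewrite ler_wpM2r ?lerDl// ltW.
    rewrite -ler_pdivlMl//; near: h.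
    by apply: nbhs_dnbhs; apply: lt_le_nbhsl; rewrite mulr_gt0 ?invr_gt0.
  split; last exact: cvg_lim cv.
  by apply/cvg_ex; exists 0.
Unshelve. all: by end_near. Qed.

End Flat.

(** * Smooth functions and bump functions on a manifold *)

Section SmoothOn.
Local Open Scope classical_set_scope.
Local Open Scope ring_scope.
Context {R : realType} {n : nat} {M : manifold R n}.
Implicit Types (U W : set M) (f g : M -> R) (i : chart M).

Lemma chart_image_setI i U : cmap i @` (cdom i `&` U) =
  (cmap i @` cdom i) `&` (cinv i @^-1` U).
Proof.
apply/seteqP; split=> [_ [p [ip Up] <-]|_ [[p ip <-]]] /=.
  by rewrite cmapK//; split=> //; exists p.
by rewrite cmapK// => Up; exists p.
Qed.

(** Charts are homeomorphisms onto their images, so every coordinate domain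
    below is open in the coordinate space. *)
Lemma open_chart_image i U : open U -> open (cmap i @` (cdom i `&` U)).
Proof.
move=> oU; have oI := @cimg_open _ _ _ i.
rewrite chart_image_setI openE => x [Ix Ux]; apply: filterI.
  exact: open_nbhs_nbhs (conj oI Ix).
have := @cinv_continuous _ _ _ i; rewrite continuous_open_subspace// => ci.
have /= := ci x (mem_set Ix); apply; exact: open_nbhs_nbhs (conj oU Ux).
Qed.

Lemma smooth_onS U W f : W `<=` U -> smooth_on U f -> smooth_on W f.
Proof.
move=> WU sf i; apply: smooth_funS (sf i).
by apply: image_subset => p [ip /WU].
Qed.

Lemma smooth_on_local U f :
  (forall p, U p -> exists W, W p /\ smooth_on W f) -> smooth_on U f.
Proof.
move=> H i; apply: smooth_fun_local => _ [p [ip /H[W [Wp sf]]] <-].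
by exists (cmap i @` (cdom i `&` W)); split=> //; exists p.
Qed.

Lemma smooth_on_eq U f g : open U -> (forall p, U p -> f p = g p) ->
  smooth_on U f -> smooth_on U g.
Proof.
move=> oU fg sf i; apply: smooth_fun_eq (sf i); first exact: open_chart_image.
by move=> _ [p [ip Up] <-] /=; rewrite cmapK//; exact: fg.
Qed.

Lemma smooth_on_cst U (c : R) : smooth_on U (fun=> c).
Proof. by move=> i; exact: smooth_fun_cst. Qed.

Lemma smooth_onD U f g : open U -> smooth_on U f -> smooth_on U g ->
  smooth_on U (fun p => f p + g p).
Proof.
by move=> oU sf sg i; apply: (smooth_funD _ (sf i) (sg i)); exact: open_chart_image.
Qed.

Lemma smooth_onM U f g : open U -> smooth_on U f -> smooth_on U g ->
  smooth_on U (fun p => f p * g p).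
Proof.
by move=> oU sf sg i; apply: (smooth_funM _ (sf i) (sg i)); exact: open_chart_image.
Qed.

Lemma smooth_on_sum U (I : Type) (s : seq I) (P : pred I) (F : I -> M -> R) :
  open U -> (forall k, P k -> smooth_on U (F k)) ->
  smooth_on U (fun p => \sum_(k <- s | P k) F k p).
Proof.
move=> oU sF i; apply: (@smooth_fun_sum _ _ _ _ s P (fun k x => F k (cinv i x))).
  exact: open_chart_image.
by move=> k Pk; exact: sF.
Qed.

(** Take a product of functions [flat 1] supported in a small box around [p] in
    a chart, extended by zero.  The box is compact, so its image in [M] is
    compact, hence closed because [M] is Hausdorff; this is why the extension by
    zero is smooth across the boundary of the chart. *)
Lemma bump_function U p : open U -> U p ->
  exists chi K, [/\ smooth chi, chi p != 0, closed K, K `<=` U &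
    forall q, ~ K q -> chi q = 0].
Proof.
move=> oU Up; have [i ip] := cdom_cover p; set x0 := cmap i p.
have oV := @open_chart_image i _ oU.
have Vx0 : (cmap i @` (cdom i `&` U)) x0 by exists p.
have /nbhs_ballP[d /= d0 dV] := open_nbhs_nbhs (conj oV Vx0).
(* half the radius, so that the closed box stays inside the open ball *)
pose e := d / 2; have e0 : 0 < e by rewrite divr_gt0.
have ed : e < d by rewrite /e ltr_pdivrMr// ltr_pMr// ltr1n.
pose B := [set x : 'rV[R]_n | forall b, [set` `[x0 0 b - e, x0 0 b + e]] (x 0 b)].
have BV : B `<=` cmap i @` (cdom i `&` U).
  apply: subset_trans dV => x Bx; split=> // a b; rewrite ord1.
  have := Bx b; rewrite /ball/= in_itv/= => /andP[h1 h2].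
  by apply: le_lt_trans ed; rewrite ler_distlC h1 h2.
have cB : compact B.
  apply: (@rV_compact R n (fun b => [set` `[x0 0 b - e, x0 0 b + e]])) => b.
  exact: segment_compact.
pose K := cinv i @` B.
have KU : K `<=` U.
  by move=> _ [x /BV[q [iq Uq] <-] <-]; rewrite cmapK.
have cK : closed K.
  apply: compact_closed; first exact: m_hausdorff.
  apply: continuous_compact => //.
  apply: continuous_subspaceW (@cinv_continuous _ _ _ i).
  by apply: subset_trans BV _; apply: image_subset => q [].
pose psi (x : 'rV[R]_n) : R :=
  \prod_(b < n) (flat 1 (x 0 b - x0 0 b + e) * flat 1 (x0 0 b + e - x 0 b)).
pose chi q := if pselect (cdom i q) then psi (cmap i q) else 0.
have chi0 q : ~ K q -> chi q = 0.
  move=> nKq; rewrite /chi; case: pselect => // iq.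
  have [b nb] : exists b, ~ [set` `[x0 0 b - e, x0 0 b + e]] (cmap i q 0 b).
    apply/existsNP => Bq; apply: nKq; exists (cmap i q) => //; exact: cmapK.
  rewrite /psi (bigD1 b)//=; apply/eqP; rewrite mulf_eq0; apply/orP; left.
  rewrite mulf_eq0; apply: contra_notT nb; rewrite negb_or => /andP[h1 h2] /=.
  rewrite in_itv/=; apply/andP; split; rewrite leNgt.
    apply: contra h1 => h1; apply/eqP/flat_le0; lra.
  apply: contra h2 => h2; apply/eqP/flat_le0; lra.
exists chi, K; split=> //; last first.
  rewrite /chi; case: pselect => // ip'; apply/prodf_neq0 => b _.
  have fe : flat 1 e != 0 by rewrite /flat e0 hornerC mul1r gt_eqF// expR_gt0.
  by rewrite subrr add0r addrAC subrr add0r mulf_neq0.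
have oi := @cdom_open _ _ _ i.
apply: smooth_on_local => q _; have [iq|niq] := pselect (cdom i q); last first.
  exists (~` K); split.
    by move=> Kq; apply: niq; case: Kq => x /BV[q' [iq' Uq'] <-] <-; rewrite cmapK.
  apply: smooth_on_eq (smooth_on_cst _ 0); first exact: closed_openC.
  by move=> q' /chi0.
exists (cdom i); split=> //.
apply: (@smooth_on_eq _ (psi \o cmap i)) => //.
  by move=> q' iq'; rewrite /chi; case: pselect.
move=> i'; rewrite /psi.
have oW := @open_chart_image i' _ oi.
have sc b := @ctransition _ _ M i' i b.
have sflat (f : 'rV[R]_n -> R) : smooth_fun (cmap i' @` (cdom i' `&` cdom i)) f ->
    smooth_fun (cmap i' @` (cdom i' `&` cdom i)) (fun x => flat 1 (f x)).
  apply: (@smooth_fun_comp _ _ _ (range flat)) => //.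
  by move=> _ [P _ <-]; exists (flat ((P - P^`()) * 'X^2)) => // t; exact: is_derive_flat.
apply: smooth_fun_prod => // b; apply: smooth_funM => //; apply: sflat.
  apply: smooth_funD => //; last exact: smooth_fun_cst.
  by apply: smooth_funD => //; exact: smooth_fun_cst.
apply: smooth_fun_eq (smooth_funD oW (smooth_fun_cst _ (x0 0 b + e))
  (smooth_funZ (-1) oW (sc b))) => // x _.
by rewrite mulN1r.
Qed.

End SmoothOn.

(** * Global sections and superfunctions *)

Section BundleSections.
Local Open Scope classical_set_scope.
Local Open Scope ring_scope.
Context {R : realType} {n : nat} {M : manifold R n} {r : nat}.
Variable E : vector_bundle M r.
Implicit Types (j : triv E) (s t : section_of E) (f : superfun E).

Lemma tmapD j p (v w : E p) : tdom j p -> tmap j (v + w) = tmap j v + tmap j w.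
Proof. by move=> jp; have := tmap_linear jp 1 v w; rewrite !scale1r. Qed.

Lemma tmap0 j p : tdom j p -> tmap j (0 : E p) = 0.
Proof.
move=> jp; have /eqP := tmapD (0 : E p) 0 jp.
by rewrite addr0 -subr_eq subrr eq_sym => /eqP.
Qed.

Lemma tmapZ j p a (v : E p) : tdom j p -> tmap j (a *: v) = a *: tmap j v.
Proof. by move=> jp; have := tmap_linear jp a v 0; rewrite tmap0// !addr0. Qed.

Lemma frame_expansion j p (v : E p) : tdom j p ->
  v = \sum_(a < r) tmap j v 0 a *: frame j p a.
Proof.
move=> jp; rewrite -[LHS](tmapK jp) [in LHS](row_sum_delta (tmap j v)).
have : {morph tinv j p : x y / x + y}.
  by move=> x y; rewrite -{1}(tinvK jp x) -{1}(tinvK jp y) -tmapD// tmapK.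
have tinv0 : tinv j p 0 = 0 by rewrite -(tmap0 jp) tmapK.
move=> tD; rewrite (big_morph _ tD tinv0); apply: eq_bigr => a _.
by rewrite -{1}(tinvK jp (delta_mx 0 a)) -tmapZ// tmapK.
Qed.

(** The algebroid differential is only known on global sections, while forms are
    evaluated on local frames: multiply the frame by a bump function. *)
Lemma frame_extension j p a : tdom j p ->
  exists s, smooth_section s /\ s p = frame j p a.
Proof.
move=> jp; have oj := @tdom_open _ _ _ _ E j.
have [chi [K [schi chip cK Kj chi0]]] := bump_function oj jp.
pose s q : E q := if pselect (tdom j q) then (chi q / chi p) *: frame j q a else 0.
exists s; split; last first.
  by rewrite /s; case: pselect => // jp'; rewrite divff// scale1r.
move=> k b; have ok := @tdom_open _ _ _ _ E k.
apply: smooth_on_local => q kq; have [jq|njq] := pselect (tdom j q).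
  exists (tdom j `&` tdom k); split=> //.
  have ojk : open (tdom j `&` tdom k) by exact: openI.
  apply: (@smooth_on_eq _ _ _ _ (fun q => (chi q * (chi p)^-1) *
      tmap k (tinv j q (delta_mx 0 a)) 0 b)) => //.
    move=> q' [jq' kq']; rewrite /s; case: pselect => // jq''.
    by rewrite tmapZ// mxE.
  apply: smooth_onM => //; last exact: ttransition.
  apply: smooth_onM => //; last exact: smooth_on_cst.
  exact: smooth_onS schi.
exists (~` K `&` tdom k); split; first by split=> // /Kj.
apply: smooth_on_eq (smooth_on_cst _ 0); first exact: openI (closed_openC cK) ok.
move=> q' [Kq' kq']; rewrite /s; case: pselect => [jq'|njq'].
  by rewrite chi0// mul0r scale0r tmap0// mxE.
by rewrite tmap0// mxE.
Qed.

Lemma superfunD f p us x y ws : is_superfun f ->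
  f p (us ++ (x + y) :: ws) = f p (us ++ x :: ws) + f p (us ++ y :: ws).
Proof. by move=> sf; have := superfun_linear sf us ws 1 x y; rewrite scale1r mul1r. Qed.

Lemma superfun0 f p us ws : is_superfun f -> f p (us ++ 0 :: ws) = 0.
Proof.
move=> sf; have /eqP := superfunD us 0 0 ws sf.
by rewrite addr0 -subr_eq subrr eq_sym => /eqP.
Qed.

Lemma superfunZ f p us a x ws : is_superfun f ->
  f p (us ++ a *: x :: ws) = a * f p (us ++ x :: ws).
Proof.
by move=> sf; have := superfun_linear sf us ws a x 0; rewrite addr0 superfun0// addr0.
Qed.

(** Polarization of the alternating condition on [x + y]. *)
Lemma superfun_swap f p us x y ws : is_superfun f ->
  f p (us ++ x :: y :: ws) = - f p (us ++ y :: x :: ws).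
Proof.
move=> sf; apply/eqP; rewrite -addr_eq0; apply/eqP.
have := superfun_alternating sf us [::] ws (x + y).
rewrite /= superfunD// -!(cat_rcons _ us) !superfunD// !cat_rcons.
have a0 z := superfun_alternating sf us [::] ws z.
by rewrite /= in a0; rewrite !a0 add0r addr0.
Qed.

(** Expand the global sections one at a time in the local frame; on frames the
    values are smooth by definition of a superfunction. *)
Lemma smooth_on_superfun f j (fr : seq 'I_r) (ss : seq (section_of E)) :
  is_superfun f ->
  (forall i, (i < size ss)%N -> smooth_section (nth (fun=> 0) ss i)) ->
  smooth_on (tdom j) (fun p => f p ([seq frame j p a | a <- fr] ++ at_point p ss)).
Proof.
move=> sf; have oj := @tdom_open _ _ _ _ E j.
elim: ss fr => [|s ss IH] fr sss.
  apply: smooth_on_eq (superfun_smooth sf j fr) => // p jp.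
  by rewrite /at_point cats0.
apply: (@smooth_on_eq _ _ _ _ (fun p => \sum_(a < r) tmap j (s p) 0 a *
   f p ([seq frame j p a | a <- rcons fr a] ++ at_point p ss))) => //.
  move=> p jp; rewrite /at_point/= {2}(frame_expansion (s p) jp).
  rewrite (big_morph (fun v => f p (_ ++ v :: _)) (fun x y => superfunD _ x y _ sf)
    (superfun0 _ _ sf)); apply: eq_bigr => a _.
  by rewrite superfunZ// map_rcons cat_rcons.
apply: smooth_on_sum => // a _; apply: smooth_onM => //; first exact: (sss 0%N).
by apply: IH => i; exact: (sss i.+1).
Qed.

Lemma smooth_superfun f (ss : seq (section_of E)) : is_superfun f ->
  (forall i, (i < size ss)%N -> smooth_section (nth (fun=> 0) ss i)) ->
  smooth (fun p => f p (at_point p ss)).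
Proof.
move=> sf sss; apply: smooth_on_local => p _; have [j jp] := tdom_cover E p.
by exists (tdom j); split=> //; exact: (smooth_on_superfun j [::]).
Qed.

End BundleSections.

(** * The Chevalley-Eilenberg differential *)

Section ChevalleyEilenberg.
Local Open Scope classical_set_scope.
Local Open Scope ring_scope.
Context {R : realType} {n : nat} {M : manifold R n} {r : nat}.
Context {E : vector_bundle M r}.
Variable A : lie_algebroid E.

Definition cochain := seq (section_of E) -> M -> R.

Implicit Types (F G : cochain) (x y z : section_of E) (ss : seq (section_of E)).

(** Same as the condition of [algebroid_differential], in a form that follows
    the recursion on the list of arguments. *)
Fixpoint smooth_seq ss : Prop :=
  if ss is s :: ss' then smooth_section s /\ smooth_seq ss' else True.

Lemma smooth_seqP ss : smooth_seq ss <->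
  (forall i, (i < size ss)%N -> smooth_section (nth (fun=> 0) ss i)).
Proof.
elim: ss => [|s ss IH] //=; split=> [[sm /IH H] [|i] //= /H//|H].
by split; [exact: (H 0%N)|apply/IH => i; exact: (H i.+1)].
Qed.

(** Insertion of [x] in the first argument: the contraction [i_x]. *)
Definition first_slot x F : cochain := fun ss => F (x :: ss).

(** The Lie derivative of a cochain.  The recursion is the relation
    [i_y L_x = L_x i_y - i_[x,y]]. *)
Fixpoint lie x F ss : M -> R :=
  if ss is y :: ss' then lie x (first_slot y F) ss' - F (bracket A x y :: ss')
  else fun p => anchor A (x p) (F [::]).

(** The Chevalley-Eilenberg differential.  The recursion is the Cartan formula
    [i_x d = L_x - d i_x], so both this relation and the previous one hold by
    definition. *)
Fixpoint ce_diff F ss : M -> R :=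
  if ss is x :: ss' then lie x F ss' - ce_diff (first_slot x F) ss' else 0.

Definition smooth_cochain F := forall ss, smooth_seq ss -> smooth (F ss).

(** Additivity in the form in which [bracket_jacobi_left] provides it: a pointwise
    difference of sections. *)
Definition subtractive_cochain F := forall us x y z ws,
  smooth_section x -> smooth_section y -> smooth_section z ->
  (forall p, x p = y p - z p) -> F (us ++ x :: ws) = F (us ++ y :: ws) - F (us ++ z :: ws).

Lemma anchorB p (v : E p) (f g : M -> R) : smooth f -> smooth g ->
  anchor A v (f - g) = anchor A v f - anchor A v g.
Proof.
move=> sf sg; have [+ _] := anchor_tangent A v => /(_ (-1) g f sg sf).
rewrite mulN1r addrC => <-; congr (anchor A v _).
by apply/funext => q; rewrite mulN1r addrC.
Qed.

Lemma smoothB (f g : M -> R) : smooth f -> smooth g -> smooth (f - g).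
Proof.
move=> sf sg.
apply: (smooth_on_eq openT _ (smooth_onD openT sf
  (smooth_onM openT (smooth_on_cst _ (-1)) sg))) => p _.
by rewrite mulN1r.
Qed.

Lemma smooth0 : smooth (0 : M -> R).
Proof. exact: smooth_on_cst. Qed.

Lemma anchor0 p (v : E p) : anchor A v 0 = 0.
Proof. by rewrite -(subr0 (0 : M -> R)) anchorB ?subrr//; exact: smooth0. Qed.

Lemma smooth_contract x F :
  smooth_section x -> smooth_cochain F -> smooth_cochain (first_slot x F).
Proof. by move=> sx sF ss sss; exact: sF. Qed.

Lemma subtractive_contract x F :
  subtractive_cochain F -> subtractive_cochain (first_slot x F).
Proof. by move=> aF us; exact: (aF (x :: us)). Qed.

Lemma smooth_lie x F :
  smooth_section x -> smooth_cochain F -> smooth_cochain (lie x F).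
Proof.
move=> sx sF ss; elim: ss F sF => [|y ss IH] F sF /=.
  by move=> _; apply: anchor_smooth => //; exact: sF.
move=> [sy sss]; apply: smoothB; first by apply: IH => //; exact: smooth_contract.
by apply: sF; split=> //; exact: bracket_smooth.
Qed.

Lemma smooth_ce_diff F : smooth_cochain F -> smooth_cochain (ce_diff F).
Proof.
move=> sF ss; elim: ss F sF => [|y ss IH] F sF /=; first by move=> _; exact: smooth0.
move=> [sy sss]; apply: smoothB; first exact: smooth_lie.
by apply: IH => //; exact: smooth_contract.
Qed.

Lemma lieB x F G ss : smooth_section x -> smooth_cochain F -> smooth_cochain G ->
  smooth_seq ss -> lie x (F - G) ss = lie x F ss - lie x G ss.
Proof.
move=> sx; elim: ss F G => [|y ss IH] F G sF sG /=.
  move=> _; apply/funext => p; rewrite -[RHS]/(_ - _) -anchorB//.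
  - exact: (sF [::]).
  - exact: (sG [::]).
move=> [sy sss]; rewrite -[first_slot y (F - G)]/(first_slot y F - first_slot y G).
rewrite IH//; [|exact: smooth_contract|exact: smooth_contract].
rewrite -[(F - G) _]/(F _ - G _) !opprD !opprK -!addrA; congr (_ + _).
by rewrite addrCA.
Qed.

Lemma ce_diffB F G ss : smooth_cochain F -> smooth_cochain G ->
  smooth_seq ss -> ce_diff (F - G) ss = ce_diff F ss - ce_diff G ss.
Proof.
elim: ss F G => [|y ss IH] F G sF sG /=; first by rewrite subrr.
move=> [sy sss]; rewrite -[first_slot y (F - G)]/(first_slot y F - first_slot y G).
rewrite IH//; [|exact: smooth_contract|exact: smooth_contract].
by rewrite lieB// !opprD !opprK -!addrA; congr (_ + _); rewrite addrCA.
Qed.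

(** Jacobi identity in the form [ad [x,y] = [ad x, ad y]], for which it is
    convenient to have only minus signs between brackets. *)
Lemma bracket_jacobi_left x y z p :
  smooth_section x -> smooth_section y -> smooth_section z ->
  bracket A (bracket A x y) z p
    = bracket A x (bracket A y z) p - bracket A y (bracket A x z) p.
Proof.
move=> sx sy sz.
have sb u v : smooth_section u -> smooth_section v -> smooth_section (bracket A u v).
  exact: bracket_smooth.
(* [- v] as the combination [(- 2) v + v], to which [bracket_linear] applies *)
have Ezx : bracket A z x = (fun q => (- 2) *: bracket A x z q + bracket A x z q).
  apply/functional_extensionality_dep => q; rewrite bracket_antisym//.
  by rewrite -{3}[bracket A x z q]scale1r -scalerDl -scaleN1r; congr (_ *: _); ring.
have Eyzx : bracket A y (bracket A z x) p = - bracket A y (bracket A x z) p.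
  have E1 : bracket A (bracket A x z) y p = - bracket A y (bracket A x z) p.
    by apply: bracket_antisym => //; exact: sb.
  rewrite bracket_antisym//; last exact: sb.
  rewrite -E1 Ezx bracket_linear//; try exact: sb.
  by rewrite scaleNr opprD opprK scaler_nat mulr2n addrK.
have := bracket_jacobi A sx sy sz p.
rewrite Eyzx [bracket A z _ p]bracket_antisym//; last exact: sb.
by move=> /eqP; rewrite subr_eq0 => /eqP.
Qed.

(** [[L_x, L_y] = L_[x,y]].  On functions this is the compatibility of the
    anchor with the brackets.  Contracting both sides with [z] and commuting
    [i_z] to the right leaves the same identity with one argument less, and the
    Jacobi identity. *)
Lemma lie_lie x y F ss : smooth_section x -> smooth_section y ->
  smooth_cochain F -> subtractive_cochain F -> smooth_seq ss ->
  lie x (lie y F) ss - lie y (lie x F) ss = lie (bracket A x y) F ss.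
Proof.
move=> sx sy; elim: ss F => [|z ss IH] F sF aF.
  move=> _; apply/funext => p; rewrite /= -[LHS]/(_ - _) /= anchor_bracket//.
  exact: (sF [::]).
move=> [sz sss].
have sb u v : smooth_section u -> smooth_section v -> smooth_section (bracket A u v).
  exact: bracket_smooth.
have sc := smooth_contract.
have E1 u : first_slot z (lie u F) = lie u (first_slot z F) - first_slot (bracket A u z) F by [].
rewrite [LHS]/= !E1 !lieB//; do ?[exact: sb|apply: smooth_lie => //|apply: sc => //].
rewrite [RHS]/= -IH//; [|exact: sc|exact: subtractive_contract].
rewrite (aF [::] _ _ _ ss (sb _ _ (sb _ _ sx sy) sz) (sb _ _ sx (sb _ _ sy sz))
  (sb _ _ sy (sb _ _ sx sz)) (fun p => bracket_jacobi_left p sx sy sz)).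
apply/funext => p; rewrite !fctE /=; ring.
Qed.

(** [[L_x, d] = 0], again by contracting with the first argument: the terms in
    which no induction hypothesis applies cancel by [lie_lie]. *)
Lemma lie_ce_diff x F ss : smooth_section x ->
  smooth_cochain F -> subtractive_cochain F -> smooth_seq ss ->
  lie x (ce_diff F) ss = ce_diff (lie x F) ss.
Proof.
move=> sx; elim: ss F => [|y ss IH] F sF aF /=.
  by move=> _; apply/funext => p; rewrite anchor0.
move=> [sy sss]; have sb : smooth_section (bracket A x y) by exact: bracket_smooth.
have sc := smooth_contract.
rewrite -[first_slot y (ce_diff F)]/(lie y F - ce_diff (first_slot y F)).
rewrite -[first_slot y (lie x F)]/(lie x (first_slot y F) - first_slot (bracket A x y) F).
rewrite lieB// ?ce_diffB//; [|by do ?[apply: sc|apply: smooth_lie|apply: smooth_ce_diff]..].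
rewrite IH//; [|exact: sc|exact: subtractive_contract].
rewrite -(lie_lie sx sy sF aF sss); apply/funext => p; rewrite !fctE /=; ring.
Qed.

(** [i_x d d = L_x d - d L_x + d d i_x], so induction applies. *)
Lemma ce_diff_ce_diff F ss : smooth_cochain F -> subtractive_cochain F ->
  smooth_seq ss -> ce_diff (ce_diff F) ss = 0.
Proof.
elim: ss F => [|x ss IH] F sF aF //= [sx sss].
rewrite -[first_slot x (ce_diff F)]/(lie x F - ce_diff (first_slot x F)).
have sc : smooth_cochain (first_slot x F) by exact: smooth_contract.
rewrite ce_diffB//; [|exact: smooth_lie|exact: smooth_ce_diff].
rewrite IH//; last exact: subtractive_contract.
by rewrite subr0 lie_ce_diff// subrr.
Qed.

End ChevalleyEilenberg.

(** * The Koszul formula and the square of the algebroid differential *)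

Section Koszul.
Local Open Scope classical_set_scope.
Local Open Scope ring_scope.
Context {R : realType} {n : nat} {M : manifold R n} {r : nat}.
Context {E : vector_bundle M r}.
Variable A : lie_algebroid E.
Local Notation cochain := (@cochain R n M r E).
Implicit Types (F G : cochain) (x y z : section_of E) (ss : seq (section_of E)).
Implicit Types (f : superfun E).

Definition alternating_cochain F := forall us x y ws,
  F (us ++ x :: y :: ws) = - F (us ++ y :: x :: ws).

Lemma alternating_contract x F :
  alternating_cochain F -> alternating_cochain (first_slot x F).
Proof. by move=> aF us; exact: (aF (x :: us)). Qed.

Definition koszul_cochain F ss (p : M) : R :=
  let s i := nth (fun q => 0) ss i in
  \sum_(i < size ss)
     (-1) ^+ i * anchor A (s i p) (fun q => F (omit i ss) q)
  + \sum_(i < size ss) \sum_(j < size ss | (i < j)%N)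
     (-1) ^+ (i + j) * F (bracket A (s i) (s j) :: omit i (omit j ss)) p.

Definition cochain_of f : cochain := fun ss p => f p (at_point p ss).

(** The Koszul formula only sees a superfunction through its values on
    sections. *)
Lemma koszulE f ss p : koszul A f ss p = koszul_cochain (cochain_of f) ss p.
Proof. by []. Qed.

Lemma omitS (T : Type) i (a : T) s : omit i.+1 (a :: s) = a :: omit i s.
Proof. by []. Qed.

Lemma omit0 (T : Type) (a : T) s : omit 0 (a :: s) = s.
Proof. by rewrite /omit /= drop0. Qed.

(** In [lie] the bracket stays at the place of the argument that it replaces;
    for an alternating cochain it can be moved to the front, as in the Koszul
    formula. *)
Lemma lie_alternating x F ss p : alternating_cochain F ->
  lie A x F ss p = anchor A (x p) (F ss)
   - \sum_(j < size ss) (-1) ^+ j *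
       F (bracket A x (nth (fun q => 0) ss j) :: omit j ss) p.
Proof.
elim: ss F => [|y ss IH] F aF /=; first by rewrite big_ord0 subr0.
rewrite !fctE IH; last exact: alternating_contract.
rewrite big_ord_recl /= expr0 mul1r omit0 opprD addrA [RHS]addrAC.
congr (_ - _ - _); apply: eq_bigr => j _.
by rewrite /bump /= add1n omitS (aF [::]) exprS /first_slot opprfctE mulN1r mulrNN.
Qed.

(** Split off the terms of the Koszul formula that involve the first section
    [x]: they add up to [L_x].  In the remaining ones [x] is an idle argument,
    and the swap with the bracket in front of it produces the sign of
    [- d i_x]. *)
Lemma koszul_ce_diff F ss p : alternating_cochain F ->
  koszul_cochain F ss p = ce_diff A F ss p.
Proof.
elim: ss F => [|x ss IH] F aF; first by rewrite /koszul_cochain !big_ord0 addr0.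
rewrite /= !fctE lie_alternating// -IH; last exact: alternating_contract.
rewrite /koszul_cochain /= !big_ord_recl /= expr0 mul1r omit0 -!addrA; congr (_ + _).
under eq_bigr => i _ do rewrite omitS /bump /= add1n exprS mulN1r mulNr.
under [X in _ + (_ + X)]eq_bigr => i _.
  rewrite big_mkcond big_ord_recl /= add0r.
  under eq_bigr => j _.
    rewrite /bump /= !add1n ltnS !omitS (aF [::]) opprfctE addnS exprS.
    rewrite addSn exprS !mulN1r !opprK mulrN.
    over.
  rewrite -big_mkcond sumrN /=.
  over.
rewrite !sumrN [X in _ + (X - _)]big_mkcond big_ord_recl /= add0r.
under [X in _ + (X - _)]eq_bigr => j _.
  rewrite /bump /= add1n omitS omit0 add0n exprS mulN1r mulNr.
  over.
by rewrite sumrN opprD addrCA.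
Qed.

Lemma smooth_cochain_of f : is_superfun f -> smooth_cochain (cochain_of f).
Proof. by move=> sf ss /smooth_seqP sss; exact: smooth_superfun. Qed.

Lemma alternating_cochain_of f : is_superfun f -> alternating_cochain (cochain_of f).
Proof.
move=> sf us x y ws; apply/funext => p.
by rewrite opprfctE /cochain_of /at_point !map_cat superfun_swap.
Qed.

Lemma subtractive_cochain_of f : is_superfun f -> subtractive_cochain (cochain_of f).
Proof.
move=> sf us x y z ws _ _ _ E1; apply/funext => p.
rewrite !fctE /cochain_of /at_point !map_cat /= E1.
by rewrite superfunD// -scaleN1r superfunZ// mulN1r.
Qed.

End Koszul.

Section Square.
Local Open Scope classical_set_scope.
Local Open Scope ring_scope.
Context {R : realType} {n : nat} {M : manifold R n} {r : nat}.
Context {E : vector_bundle M r} (A : lie_algebroid E).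
Context (dA : superfun E -> superfun E) (hdA : algebroid_differential A dA).
Implicit Types (f : superfun E) (ss : seq (section_of E)).

Lemma dA_superfun f : is_superfun f -> is_superfun (dA f).
Proof. by move=> /hdA[]. Qed.

Lemma dA_ce_diff f ss : is_superfun f -> smooth_seq ss ->
  cochain_of (dA f) ss = ce_diff A (cochain_of f) ss.
Proof.
move=> sf /smooth_seqP sss; apply/funext => p.
rewrite -koszul_ce_diff; last exact: alternating_cochain_of.
by rewrite -koszulE; case: (hdA sf) => _; exact.
Qed.

(** Cochains coming from superfunctions are only controlled on smooth sections,
    so the operators must be seen to depend on these values alone. *)
Lemma lie_ext x (F G : @cochain R n M r E) ss : smooth_section x ->
  (forall ss, smooth_seq ss -> F ss = G ss) ->
  smooth_seq ss -> lie A x F ss = lie A x G ss.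
Proof.
move=> sx; elim: ss F G => [|y ss IH] F G FG /=; first by rewrite FG.
move=> [sy sss]; rewrite FG; last by split=> //; exact: bracket_smooth.
by rewrite (IH _ (first_slot y G))// => ss' sss'; exact: FG.
Qed.

Lemma ce_diff_ext (F G : @cochain R n M r E) ss :
  (forall ss, smooth_seq ss -> F ss = G ss) ->
  smooth_seq ss -> ce_diff A F ss = ce_diff A G ss.
Proof.
elim: ss F G => [//|y ss IH] F G FG /= [sy sss].
have FG' ss' : smooth_seq ss' -> first_slot y F ss' = first_slot y G ss'.
  by move=> sss'; exact: FG.
by rewrite (lie_ext sy FG sss) (IH _ _ FG' sss).
Qed.

(** At [p] the frame vectors are values of global sections, on which [d_A] is
    the Chevalley-Eilenberg differential. *)
Lemma dA_dA_frame f (j : triv E) (p : M) (s : seq 'I_r) : is_superfun f -> tdom j p ->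
  @dA (@dA f) p [seq frame j p a | a <- s] = 0.
Proof.
move=> sf jp; have /choice[G sG] := fun a => frame_extension a jp.
have -> : [seq frame j p a | a <- s] = at_point p [seq G a | a <- s].
  by rewrite /at_point -map_comp; apply: eq_map => a /=; case: (sG a).
have sss : smooth_seq [seq G a | a <- s].
  by elim: (s) => //= a s' IH; split=> //; case: (sG a).
have sdf := dA_superfun sf.
rewrite -[LHS]/(cochain_of (dA (dA f)) _ p) dA_ce_diff//.
rewrite (ce_diff_ext (fun ss => @dA_ce_diff f ss sf) sss).
rewrite ce_diff_ce_diff//; [exact: smooth_cochain_of|exact: subtractive_cochain_of].
Qed.

End Square.

(** * The algebra of coordinate expansions *)

Section Algebra.
Import boot.finset.
Context {R : realType} {n : nat} {M : manifold R n} {r : nat}.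
Variable E : vector_bundle M r.
Implicit Types (S T U : {set 'I_(r + n)}) (b c : 'I_(r + n)) (a : 'I_r).
Implicit Types (m : {ffun 'I_r -> nat}) (w : diff_form E).

(** Counting inversions as a double sum makes them additive in both sets; all
    the signs below come from this. *)
Lemma inversionsE T U : inversions T U = (\sum_(b in T) \sum_(c in U) (c < b))%N.
Proof.
rewrite /inversions -sum1_card pair_big_dep /= big_mkcond [RHS]big_mkcond.
apply: eq_bigr => -[b c] _ /=; rewrite !inE /= andbA.
by do 2?case: ifP => //=; case: (_ < _)%N.
Qed.

Lemma inversionsU1l c T U : c \notin T ->
  inversions (c |: T) U = (inversions [set c] U + inversions T U)%N.
Proof. by move=> cT; rewrite !inversionsE big_setU1//= big_set1. Qed.

Lemma inversionsU1r c T U : c \notin U ->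
  inversions T (c |: U) = (inversions T [set c] + inversions T U)%N.
Proof.
move=> cU; rewrite !inversionsE -big_split; apply: eq_bigr => b _.
by rewrite big_setU1//= big_set1.
Qed.

Lemma inversionsD c T S : T \subset S ->
  inversions [set c] S = (inversions [set c] T + inversions [set c] (S :\: T))%N.
Proof.
move=> TS; rewrite !inversionsE !big_set1 (big_setID T) /=.
by move/setIidPr: TS => ->.
Qed.

Lemma inversions_flip c T : c \notin T ->
  (inversions T [set c] + inversions [set c] T)%N = #|T|.
Proof.
move=> cT; rewrite !inversionsE big_set1 -big_split -sum1_card /=.
apply: eq_bigr => b bT; rewrite big_set1.
by case: ltngtP => // /val_inj cb; rewrite cb bT in cT.
Qed.

Lemma inversions0 T : inversions T set0 = 0%N.
Proof. by rewrite inversionsE big1// => b _; rewrite big_set0. Qed.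

(** The subsets of [S] with and without a given element [c]. *)
Lemma sum_subset c S (F : {set 'I_(r + n)} -> R) : c \in S ->
  \sum_(T : {set _} | T \subset S) F T =
  \sum_(T : {set _} | T \subset S :\ c) F (c |: T) + \sum_(T : {set _} | T \subset S :\ c) F T.
Proof.
move=> cS; rewrite (bigID (fun T => c \in T)) /=; congr (_ + _); last first.
  by apply: eq_bigl => T; rewrite subsetD1.
rewrite (reindex_onto (fun T => c |: T) (fun T => T :\ c)) /=; last first.
  by move=> T /andP[_ cT]; rewrite setD1K.
apply: eq_bigl => T; rewrite subsetD1 subUset sub1set cS setU11 /= andbT.
congr (_ && _); apply/eqP/idP => [<-|cT]; first by rewrite setD11.
by rewrite setU1K.
Qed.

(** The multi-indices at most [m], as a list of functions with a fixed type:
    the summation type used in [form_mul] depends on [m], which hinders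
    reindexing. *)
Definition below m : seq {ffun 'I_r -> nat} :=
  [seq [ffun a => nat_of_ord (m1 a)]
     | m1 : {dffun forall a : 'I_r, 'I_(m a).+1} <- index_enum _].

Lemma mem_below m m' : (m' \in below m) = [forall a, (m' a <= m a)%N].
Proof.
apply/mapP/forallP => [[m1 _ ->] a|le]; first by rewrite ffunE -ltnS.
exists [ffun a : 'I_r => (inord (m' a) : 'I_(m a).+1)]; first by rewrite mem_index_enum.
by apply/ffunP => a; rewrite !ffunE inordK// ltnS.
Qed.

Lemma below_uniq m : uniq (below m).
Proof.
rewrite map_inj_uniq ?index_enum_uniq// => m1 m2 /ffunP E12.
by apply/ffunP => a; apply: val_inj; have := E12 a; rewrite !ffunE.
Qed.

Definition mdiff m m' := [ffun a => (m a - m' a)%N].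

Lemma form_mulE w w' i j S m p : form_mul w w' i j S m p =
  \sum_(T : {set _} | T \subset S) \sum_(m' <- below m)
    (-1) ^+ inversions T (S :\: T) * w i j T m' p * w' i j (S :\: T) (mdiff m m') p.
Proof.
rewrite /form_mul; apply: eq_bigr => T _; rewrite big_map; apply: eq_bigr => m1 _.
by congr (_ * w' _ _ _ _ _); apply/ffunP => a; rewrite !ffunE.
Qed.

Definition one_form : diff_form E := fun i j S m p =>
  ((S == set0) && (m == [ffun=> 0%N]))%:R.

(** The grading involution.  The variables [dxi] are even, so only the number of
    odd coordinates matters. *)
Definition parity w : diff_form E := fun i j S m p => (-1) ^+ #|S| * w i j S m p.

(** Left multiplication by the odd coordinate of index [c]. *)
Definition wedge c w : diff_form E := fun i j S m p =>
  if c \in S then (-1) ^+ inversions [set c] (S :\ c) * w i j (S :\ c) m p else 0.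

(** Left derivative in the odd coordinate of index [c]. *)
Definition contr c w : diff_form E := fun i j S m p =>
  if c \in S then 0 else (-1) ^+ inversions [set c] S * w i j (c |: S) m p.

Definition mdec a m : {ffun 'I_r -> nat} := [ffun a' => (m a' - (a' == a))%N].

(** Multiplication by [dxi^a]. *)
Definition theta a w : diff_form E := fun i j S m p =>
  if (0 < m a)%N then w i j S (mdec a m) p else 0.

Lemma form_ext w w' : (forall i j S m p, w i j S m p = w' i j S m p) -> w = w'.
Proof. by move=> H; do 5!apply/functional_extensionality_dep => ?; exact: H. Qed.

Lemma form_mul1 w : form_mul one_form w = w.
Proof.
apply: form_ext => i j S m p; rewrite form_mulE (bigD1 set0) ?sub0set//=.
rewrite [X in _ + X]big1 ?addr0 => [|T /andP[_ /negPf T0]]; last first.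
  by rewrite big1// => m' _; rewrite /one_form T0 mulr0 mul0r.
have m0 : [ffun=> 0%N] \in below m by rewrite mem_below; apply/forallP => a; rewrite ffunE.
rewrite (bigD1_seq _ m0 (below_uniq m)) /= big1 ?addr0 => [|m' /negPf m'0]; last first.
  by rewrite /one_form m'0 andbF mulr0 mul0r.
rewrite /one_form !eqxx setD0 mulr1 inversionsE big_set0 mul1r.
by congr (w _ _ _ _ _); apply/ffunP => a; rewrite !ffunE subn0.
Qed.

Lemma form_mul_wedgel c w w' : form_mul (wedge c w) w' = wedge c (form_mul w w').
Proof.
apply: form_ext => i j S m p; rewrite form_mulE /wedge; case: ifPn => cS; last first.
  rewrite big1// => T TS; rewrite big1// => m' _; rewrite ifN ?mulr0 ?mul0r//.
  by apply: contra cS => /(fintype.subsetP TS).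
rewrite (sum_subset _ cS) [X in _ + X]big1 ?addr0 => [|T]; last first.
  by rewrite subsetD1 => /andP[_ /negPf cT]; rewrite big1// => m' _; rewrite cT mulr0 mul0r.
rewrite form_mulE big_distrr; apply: eq_bigr => T /=.
rewrite subsetD1 => /andP[TS cT]; have TSc : T \subset S :\ c by rewrite subsetD1 TS.
have -> : S :\: (c |: T) = (S :\ c) :\: T by rewrite setDDl.
rewrite big_distrr; apply: eq_bigr => m' _ /=.
rewrite setU11 setU1K// inversionsU1l// (inversionsD c TSc) !exprD -!mulrA.
set s := (-1) ^+ inversions [set c] T; rewrite [in RHS]mulrA; ring.
Qed.

(** The odd coordinate reaches the front after passing the left factor, hence its
    parity. *)
Lemma form_mul_wedger c w w' :
  form_mul w (wedge c w') = wedge c (form_mul (parity w) w').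
Proof.
apply: form_ext => i j S m p; rewrite form_mulE /wedge; case: ifPn => cS; last first.
  rewrite big1// => T TS; rewrite big1// => m' _; rewrite ifN ?mulr0//.
  by apply: contra cS => /setDP[].
rewrite (sum_subset _ cS) [X in X + _]big1 ?add0r => [|T]; last first.
  by move=> _; rewrite big1// => m' _; rewrite ifN ?mulr0// !inE eqxx.
rewrite form_mulE big_distrr; apply: eq_bigr => T /=.
rewrite subsetD1 => /andP[TS cT]; have TSc : T \subset S :\ c by rewrite subsetD1 TS.
have E1 : (S :\: T) :\ c = (S :\ c) :\: T by rewrite !setDDl setUC.
have cST : c \in S :\: T by rewrite inE cT.
rewrite big_distrr; apply: eq_bigr => m' _ /=; rewrite cST E1.
have -> : inversions T (S :\: T) = (inversions T [set c] + inversions T ((S :\ c) :\: T))%N.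
  by rewrite -E1 -inversionsU1r ?setD1K// setD11.
rewrite (inversionsD c TSc) /parity -(inversions_flip cT) !exprD.
set s := (-1) ^+ inversions [set c] T.
have ss : s * s = 1 by rewrite -expr2 sqrr_sign.
transitivity ((s * s) * ((-1) ^+ inversions T [set c] * (-1) ^+ inversions T (S :\ c :\: T) *
w i j T m' p * ((-1) ^+ inversions [set c] (S :\ c :\: T) * w' i j (S :\ c :\: T) (mdiff m m') p))).
  by rewrite ss mul1r.
ring.
Qed.

(** The derivative reaches the right factor after passing the left one, hence its
    parity. *)
Lemma contr_form_mul c w w' : contr c (form_mul w w') =
  form_mul (contr c w) w' + form_mul (parity w) (contr c w').
Proof.
apply: form_ext => i j S m p; rewrite -[RHS]/(form_mul _ _ i j S m p + form_mul _ _ i j S m p).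
rewrite !form_mulE /contr; case: ifPn => cS.
  rewrite !(sum_subset _ cS) [X in _ = X + _ + _]big1 ?add0r => [|T TS]; last first.
    by rewrite big1// => m' _; rewrite setU11 mulr0 mul0r.
  rewrite [X in _ = _ + (_ + X)]big1 ?addr0 => [|T TS]; last first.
    move: TS; rewrite subsetD1 => /andP[_ cT].
    by rewrite big1// => m' _; rewrite inE cT cS mulr0.
  rewrite -big_split big1//= => T.
  rewrite subsetD1 => /andP[TS cT]; rewrite -big_split big1//= => m' _.
  have E1 : S :\: (c |: T) = (S :\: T) :\ c by rewrite !setDDl setUC.
  have cST : c \in S :\: T by rewrite inE cT.
  have cU : c \notin (S :\: T) :\ c by rewrite setD11.
  rewrite (negPf cT) E1 (negPf cU) setD1K// /parity cardsU1 cT inversionsU1l//.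
  rewrite -[in inversions T (S :\: T)](setD1K cST) (inversionsU1r _ cU).
  rewrite -(inversions_flip cT) !exprD expr1.
  set s1 := (-1) ^+ inversions [set c] ((S :\: T) :\ c).
  have ss : s1 * s1 = 1 by rewrite -expr2 sqrr_sign.
  (* when [c] is in [S], both products contain the terms in which the two
     factors carry [c]; their signs are opposite *)
  have sgn_cancel (s x y z u v : R) : s * s = 1 ->
      x * y * (z * u) * v = - (s * y * (- 1 * (x * z) * u) * (s * v)).
    by move=> s2; rewrite -[LHS]mul1r -{1}s2; ring.
  by apply/eqP; rewrite addr_eq0; apply/eqP; exact: sgn_cancel.
rewrite form_mulE (sum_subset _ (setU11 c S)) setU1K// mulrDr !big_distrr /=.
congr (_ + _); apply: eq_bigr => T TS; rewrite !big_distrr /=; apply: eq_bigr => m' _.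
  have cT : c \notin T by apply: contra cS => /(fintype.subsetP TS).
  have cST : c \notin S :\: T by rewrite inE (negPf cS) andbF.
  have -> : (c |: S) :\: (c |: T) = S :\: T.
    by rewrite -setDDl setU1K.
  rewrite (negPf cT) inversionsU1l// (inversionsD c TS) !exprD.
  set s1 := (-1) ^+ inversions [set c] (S :\: T).
  have ss : s1 * s1 = 1 by rewrite -expr2 sqrr_sign.
  transitivity ((s1 * s1) * ((-1) ^+ inversions T (S :\: T) *
    ((-1) ^+ inversions [set c] T * w i j (c |: T) m' p) * w' i j (S :\: T) (mdiff m m') p)).
    ring.
  by rewrite ss mul1r.
have cT : c \notin T by apply: contra cS => /(fintype.subsetP TS).
have cST : c \notin S :\: T by rewrite inE (negPf cS) andbF.
have -> : (c |: S) :\: T = c |: (S :\: T).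
  by rewrite setDUl; congr (_ :|: _); apply/setDidPl; rewrite disjoints1.
rewrite (negPf cST) (inversionsU1r _ cST) (inversionsD c TS) /parity.
rewrite -(inversions_flip cT) !exprD; ring.
Qed.

Lemma sum_below_l a m (F : {ffun 'I_r -> nat} -> {ffun 'I_r -> nat} -> R) :
  (0 < m a)%N ->
  \sum_(m' <- below m) (if (0 < m' a)%N then F (mdec a m') (mdiff m m') else 0)
  = \sum_(m' <- below (mdec a m)) F m' (mdiff (mdec a m) m').
Proof.
move=> ma; rewrite -big_mkcond -big_filter.
(* adding one to the exponent of [dxi^a] is inverse to [mdec a] where the
   latter does not truncate *)
pose inc m' : {ffun 'I_r -> nat} := [ffun a' => (m' a' + (a' == a))%N].
have incK : cancel inc (mdec a) by move=> m'; apply/ffunP => a'; rewrite !ffunE addnK.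
have decK m' : (0 < m' a)%N -> inc (mdec a m') = m'.
  by move=> m'a; apply/ffunP => a'; rewrite !ffunE subnK//; case: eqP => // ->.
rewrite (perm_big [seq inc m' | m' <- below (mdec a m)]) /=; last first.
  apply: uniq_perm; first by rewrite filter_uniq// below_uniq.
    by rewrite map_inj_uniq ?below_uniq//; exact: can_inj incK.
  move=> m'; rewrite mem_filter mem_below; apply/andP/mapP => [[m'a /forallP le]|[m1]].
    exists (mdec a m'); last by rewrite decK.
    by rewrite mem_below; apply/forallP => a'; rewrite !ffunE leq_sub2r.
  rewrite mem_below => /forallP le ->; rewrite !ffunE eqxx addn1; split=> //.
  apply/forallP => a'; have := le a'; rewrite !ffunE.
  by case: eqP => [->|_]; lia.
rewrite big_map; apply: eq_big_seq => m'; rewrite mem_below => /forallP le.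
rewrite incK; congr (F _ _); apply/ffunP => a'; rewrite !ffunE; lia.
Qed.

Lemma sum_below_r a m (F : {ffun 'I_r -> nat} -> {ffun 'I_r -> nat} -> R) :
  (0 < m a)%N ->
  \sum_(m' <- below m)
     (if (0 < mdiff m m' a)%N then F m' (mdec a (mdiff m m')) else 0)
  = \sum_(m' <- below (mdec a m)) F m' (mdiff (mdec a m) m').
Proof.
move=> ma; rewrite -big_mkcond -big_filter.
rewrite (perm_big (below (mdec a m))) /=; last first.
  apply: uniq_perm; rewrite ?filter_uniq ?below_uniq// => m'.
  rewrite mem_filter !mem_below ffunE subn_gt0; apply/andP/forallP => [[m'a /forallP le] a'|le].
    by rewrite ffunE; case: eqP => [->|_]; [lia|rewrite subn0].
  split; first by have := le a; rewrite ffunE eqxx; lia.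
  by apply/forallP => a'; have := le a'; rewrite ffunE; lia.
apply: eq_bigr => m' _; congr (F _ _); apply/ffunP => a'; rewrite !ffunE; lia.
Qed.

Lemma form_mul_thetal a w w' : form_mul (theta a w) w' = theta a (form_mul w w').
Proof.
apply: form_ext => i j S m p; rewrite /theta form_mulE; case: ifPn => [ma|].
  rewrite form_mulE; apply: eq_bigr => T _.
  rewrite -(sum_below_l (fun m1 m2 => (-1) ^+ inversions T (S :\: T) * w i j T m1 p *
    w' i j (S :\: T) m2 p) ma).
  by apply: eq_bigr => m' _; case: ifP => //; rewrite mulr0 mul0r.
rewrite -eqn0Ngt => /eqP ma; rewrite big1// => T _; rewrite big1_seq// => m' /=.
rewrite mem_below => /forallP/(_ a); rewrite ma leqn0 => /eqP ->.
by rewrite mulr0 mul0r.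
Qed.

Lemma form_mul_thetar a w w' : form_mul w (theta a w') = theta a (form_mul w w').
Proof.
apply: form_ext => i j S m p; rewrite /theta form_mulE; case: ifPn => [ma|].
  rewrite form_mulE; apply: eq_bigr => T _.
  rewrite -(sum_below_r (fun m1 m2 => (-1) ^+ inversions T (S :\: T) * w i j T m1 p *
    w' i j (S :\: T) m2 p) ma).
  by apply: eq_bigr => m' _; case: ifP => //; rewrite mulr0.
rewrite -eqn0Ngt => /eqP ma; rewrite big1// => T _; rewrite big1// => m' _.
by rewrite ffunE ma sub0n mulr0.
Qed.

Lemma coord_dxE (b : 'I_n) : coord_dx b = wedge (rshift r b) one_form :> diff_form E.
Proof.
apply: form_ext => i j S m p; rewrite /coord_dx /wedge /one_form.
case: ifPn => bS; last first.
  by case: eqP => // SE; rewrite SE set11 in bS.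
rewrite setD_eq0 eq_sym eqEsubset sub1set bS /= ; case: (boolP (S \subset _)) => SE.
  have -> : S :\ rshift r b = set0 by apply/eqP; rewrite setD_eq0.
  by rewrite inversions0 mul1r.
by rewrite mulr0.
Qed.

Lemma coord_dxiE a : coord_dxi a = theta a one_form :> diff_form E.
Proof.
apply: form_ext => i j S m p; rewrite /coord_dxi /theta /one_form.
case: ifPn => [ma|]; last first.
  rewrite -eqn0Ngt => /eqP ma; case: (m =P _) => [mE|]; last by rewrite andbF.
  by have := ma; rewrite mE ffunE eqxx.
congr ((_ && _)%:R); apply/eqP/eqP => [->|mE]; apply/ffunP => a'.
  by rewrite !ffunE subnn.
have := congr1 (fun m : {ffun _} => m a') mE; rewrite !ffunE.
by case: eqP => [->|_] /=; [move/eqP; rewrite subn_eq0; move: ma; case: (m a) => [|[]]|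
  rewrite subn0].
Qed.

(** Exactly one of the two pairs is an inversion. *)
Lemma sign_flip b c : b != c ->
  (-1) ^+ inversions [set b] [set c] = - (-1) ^+ inversions [set c] [set b] :> R.
Proof.
move=> bc; have := @inversions_flip b [set c]; rewrite inE cards1 => /(_ bc).
by case: (inversions _ _) => [|[|?]]; case: (inversions _ _) => [|[|?]]//= _; rewrite ?opprK.
Qed.

Lemma wedge_wedge b c w : wedge b (wedge c w) = - wedge c (wedge b w).
Proof.
apply: form_ext => i j S m p; rewrite -[RHS]/(- _ i j S m p) /wedge !inE.
have [->|bc] := eqVneq b c; first by rewrite /= mulr0; case: ifP; rewrite oppr0.
case: (boolP (b \in S)) => bS; case: (boolP (c \in S)) => cS;
  rewrite /= ?mulr0 ?oppr0//.
have cU : c \notin S :\ b :\ c by rewrite setD11.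
have bU : b \notin S :\ c :\ b by rewrite setD11.
have EU : S :\ c :\ b = S :\ b :\ c by rewrite !setDDl setUC.
rewrite -[in inversions [set b] (S :\ b)](@setD1K _ c (S :\ b)) ?inE 1?eq_sym ?bc//.
rewrite -[in inversions [set c] (S :\ c)](@setD1K _ b (S :\ c)) ?inE ?bc//.
rewrite (inversionsU1r _ cU) (inversionsU1r _ bU) EU !exprD (sign_flip bc); ring.
Qed.

Lemma contr_contr b c w : contr b (contr c w) = - contr c (contr b w).
Proof.
apply: form_ext => i j S m p; rewrite -[RHS]/(- _ i j S m p) /contr !inE.
have [->|bc] := eqVneq b c; first by rewrite /= mulr0; case: ifP; rewrite oppr0.
case: (boolP (b \in S)) => bS; case: (boolP (c \in S)) => cS;
  rewrite /= ?mulr0 ?oppr0//.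
rewrite (inversionsU1r _ bS) (inversionsU1r _ cS) !exprD (sign_flip bc) !setUA.
rewrite [[set b] :|: _]setUC; ring.
Qed.

Lemma contr_wedge b c w : b != c -> contr b (wedge c w) = - wedge c (contr b w).
Proof.
move=> bc; apply: form_ext => i j S m p; rewrite -[RHS]/(- _ i j S m p) /contr /wedge !inE.
case: (boolP (b \in S)) => bS; case: (boolP (c \in S)) => cS;
  rewrite ?bc ?mulr0 ?oppr0//= ?orbF ?orbT 1?eq_sym ?(negPf bc) ?mulr0 ?oppr0//=.
have bU : b \notin S :\ c by rewrite inE negb_and bS orbT.
have -> : (b |: S) :\ c = b |: (S :\ c).
  by rewrite setDUl; congr (_ :|: _); apply/setDidPl; rewrite disjoints1 inE.
have cU : c \notin S :\ c by rewrite setD11.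
rewrite -[in inversions [set b] S](setD1K cS) (inversionsU1r _ bU) (inversionsU1r _ cU).
rewrite !exprD (sign_flip bc); set s := (-1) ^+ inversions [set c] [set b].
have ss : s * s = 1 by rewrite -expr2 sqrr_sign.
move: (_ ^+ _) (_ ^+ _) (w _ _ _ _ _) => x y z.
transitivity (- ((s * s) * (y * (x * z)))); first by ring.
by rewrite ss mul1r; ring.
Qed.

Lemma theta_wedge a c w : theta a (wedge c w) = wedge c (theta a w).
Proof.
by apply: form_ext => i j S m p; rewrite /theta /wedge; do 2!case: ifP => // _; rewrite mulr0.
Qed.

Lemma theta_contr a c w : theta a (contr c w) = contr c (theta a w).
Proof.
by apply: form_ext => i j S m p; rewrite /theta /contr; do 2!case: ifP => // _; rewrite mulr0.
Qed.

Lemma theta_theta a a' w : theta a (theta a' w) = theta a' (theta a w).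
Proof.
apply: form_ext => i j S m p; rewrite /theta !ffunE.
have [->//|aa'] := eqVneq a a'.
rewrite !subn0.
do 2!case: ifP => // _; congr (w _ _ _ _ _); apply/ffunP => a''; rewrite !ffunE; lia.
Qed.

Lemma parityK w : parity (parity w) = w.
Proof.
apply: form_ext => i j S m p; rewrite /parity mulrA -expr2 sqrr_sign mul1r //.
Qed.

Lemma form_mulDl w1 w2 w : form_mul (w1 + w2) w = form_mul w1 w + form_mul w2 w.
Proof.
apply: form_ext => i j S m p; rewrite -[RHS]/(form_mul _ _ i j S m p + form_mul _ _ i j S m p).
rewrite /form_mul -big_split; apply: eq_bigr => T _; rewrite -big_split.
by apply: eq_bigr => m' _ /=; rewrite -[(w1 + w2) _ _ _ _ _]/(_ + _) mulrDr mulrDl.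
Qed.

Lemma form_mulDr w1 w2 w : form_mul w (w1 + w2) = form_mul w w1 + form_mul w w2.
Proof.
apply: form_ext => i j S m p; rewrite -[RHS]/(form_mul _ _ i j S m p + form_mul _ _ i j S m p).
rewrite /form_mul -big_split; apply: eq_bigr => T _; rewrite -big_split.
by apply: eq_bigr => m' _ /=; rewrite -[(w1 + w2) _ _ _ _ _]/(_ + _) mulrDr.
Qed.

Lemma form_mulZl (k : R) w1 w : form_mul (k *: w1) w = k *: form_mul w1 w.
Proof.
apply: form_ext => i j S m p; rewrite -[RHS]/(k * form_mul _ _ i j S m p).
rewrite /form_mul big_distrr; apply: eq_bigr => T _; rewrite big_distrr.
by apply: eq_bigr => m' _ /=; rewrite -[(k *: w1) _ _ _ _ _]/(k * _); ring.
Qed.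

Lemma wedgeD c w w' : wedge c (w + w') = wedge c w + wedge c w'.
Proof.
apply: form_ext => i j S m p; rewrite -[RHS]/(wedge c w i j S m p + wedge c w' i j S m p).
by rewrite /wedge -[(w + w') _ _ _ _ _]/(_ + _); case: ifP => _; rewrite ?mulrDr ?addr0.
Qed.

Lemma contrD c w w' : contr c (w + w') = contr c w + contr c w'.
Proof.
apply: form_ext => i j S m p; rewrite -[RHS]/(contr c w i j S m p + contr c w' i j S m p).
by rewrite /contr -[(w + w') _ _ _ _ _]/(_ + _); case: ifP => _; rewrite ?mulrDr ?addr0.
Qed.

Lemma thetaD a w w' : theta a (w + w') = theta a w + theta a w'.
Proof.
apply: form_ext => i j S m p; rewrite -[RHS]/(theta a w i j S m p + theta a w' i j S m p).
by rewrite /theta -[(w + w') _ _ _ _ _]/(_ + _); case: ifP => _; rewrite ?addr0.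
Qed.

Lemma wedgeZ c (k : R) w : wedge c (k *: w) = k *: wedge c w.
Proof.
apply: form_ext => i j S m p; rewrite -[RHS]/(k * wedge c w i j S m p) /wedge.
by rewrite -[(k *: w) _ _ _ _ _]/(k * _); case: ifP => _; rewrite ?mulr0// mulrCA.
Qed.

Lemma contrZ c (k : R) w : contr c (k *: w) = k *: contr c w.
Proof.
apply: form_ext => i j S m p; rewrite -[RHS]/(k * contr c w i j S m p) /contr.
by rewrite -[(k *: w) _ _ _ _ _]/(k * _); case: ifP => _; rewrite ?mulr0// mulrCA.
Qed.

Lemma thetaZ a (k : R) w : theta a (k *: w) = k *: theta a w.
Proof.
apply: form_ext => i j S m p; rewrite -[RHS]/(k * theta a w i j S m p) /theta.
by rewrite -[(k *: w) _ _ _ _ _]/(k * _); case: ifP => _; rewrite ?mulr0.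
Qed.

End Algebra.

(** * Coordinate derivatives of forms *)

(** The cancellation behind every identity of the form [d d = 0]. *)
Lemma sum_antisym {R : numDomainType} (I : finType) (G : I -> I -> R) :
  (forall b c, G b c = - G c b) -> \sum_b \sum_c G b c = 0.
Proof.
move=> GN; set s := \sum_b _; have sN : s = - s.
  rewrite {1}/s exchange_big /= /s -sumrN; apply: eq_bigr => b _.
  by rewrite -sumrN; apply: eq_bigr => c _.
by move/eqP: sN; rewrite -addr_eq0 -mulr2n mulrn_eq0 /= => /eqP.
Qed.

Section Derivations.
Context {R : realType} {n : nat} {M : manifold R n} {r : nat}.
Variable E : vector_bundle M r.
Implicit Types (c : 'I_(r + n)) (b : 'I_n) (a : 'I_r).
Implicit Types (m : {ffun 'I_r -> nat}) (w : diff_form E).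

(** Coefficients are only required to be smooth where the coordinates are
    defined; elsewhere their values are constrained by the extension by zero. *)
Definition smooth_form w := forall i j S m,
  smooth_fun (cmap i @` coord_dom i j)%classic (fun x => w i j S m (cinv i x)).

Lemma open_coord_image (i : chart M) (j : triv E) :
  open (cmap i @` coord_dom i j)%classic.
Proof. by apply: open_chart_image; exact: tdom_open. Qed.

Lemma partial_xE b w i j S m p : coord_dom i j p ->
  partial_x b w i j S m p =
  'D_(delta_mx 0 b) (fun x => w i j S m (cinv i x)) (cmap i p).
Proof. by move=> ijp; rewrite /partial_x /patch mem_set. Qed.

Lemma partial_x_out b w i j S m p : ~ coord_dom i j p ->
  partial_x b w i j S m p = 0.
Proof. by move=> ijp; rewrite /partial_x /patch memNset. Qed.

Lemma partial_x_ext b w w' :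
  (forall i j S m p, coord_dom i j p ->
     partial_x b w i j S m p = w' i j S m p) ->
  (forall i j S m p, ~ coord_dom i j p -> w' i j S m p = 0) ->
  partial_x b w = w'.
Proof.
move=> H1 H2; apply: form_ext => i j S m p.
by have [/H1|nij] := pselect (coord_dom i j p); [exact|rewrite partial_x_out// H2].
Qed.

Lemma smooth_form_derivable b w i j S m p : smooth_form w -> coord_dom i j p ->
  derivable (fun x => w i j S m (cinv i x)) (cmap i p) (delta_mx 0 b).
Proof. by move=> sw ijp; apply: smooth_fun_derivable (sw i j S m) _; exists p. Qed.

Lemma smooth_formD w w' : smooth_form w -> smooth_form w' -> smooth_form (w + w').
Proof.
move=> sw sw' i j S m.
exact: (smooth_funD (@open_coord_image i j) (sw i j S m) (sw' i j S m)).
Qed.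

Lemma smooth_formZ (k : R) w : smooth_form w -> smooth_form (k *: w).
Proof.
move=> sw i j S m; exact: (smooth_funZ k (@open_coord_image i j) (sw i j S m)).
Qed.

Lemma smooth_form0 : smooth_form (0 : diff_form E).
Proof. move=> i j S m; exact: smooth_fun_cst. Qed.

Lemma smooth_form_sum (I : Type) (s : seq I) (F : I -> diff_form E) :
  (forall k, smooth_form (F k)) -> smooth_form (\sum_(k <- s) F k).
Proof.
move=> sF; elim: s => [|k s IH]; first by rewrite big_nil; exact: smooth_form0.
by rewrite big_cons; exact: smooth_formD.
Qed.

Lemma smooth_form_mul w w' :
  smooth_form w -> smooth_form w' -> smooth_form (form_mul w w').
Proof.
move=> sw sw' i j S m; have oV := @open_coord_image i j.
apply: smooth_fun_sum => // T _; apply: smooth_fun_sum => // m' _.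
apply: smooth_funM => //.
by apply: smooth_funM => //; exact: smooth_fun_cst.
Qed.

Lemma smooth_form_wedge c w : smooth_form w -> smooth_form (wedge c w).
Proof.
move=> sw i j S m; rewrite /wedge; case: (c \in S); last exact: smooth_fun_cst.
exact: (smooth_funZ _ (@open_coord_image i j) (sw _ _ _ _)).
Qed.

Lemma smooth_form_contr c w : smooth_form w -> smooth_form (contr c w).
Proof.
move=> sw i j S m; rewrite /contr; case: (c \in S); first exact: smooth_fun_cst.
exact: (smooth_funZ _ (@open_coord_image i j) (sw _ _ _ _)).
Qed.

Lemma smooth_form_theta a w : smooth_form w -> smooth_form (theta a w).
Proof.
by move=> sw i j S m; rewrite /theta; case: (0 < m a)%N; [exact: sw|exact: smooth_fun_cst].
Qed.

Lemma smooth_form_partial b w : smooth_form w -> smooth_form (partial_x b w).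
Proof.
move=> sw i j S m; have oV := @open_coord_image i j.
apply: smooth_fun_eq (smooth_fun_derive b (sw i j S m)) => //.
by move=> _ [p ijp <-]; rewrite cmapK ?partial_xE//; case: ijp.
Qed.

Lemma smooth_form_superfun (f : superfun E) :
  is_superfun f -> smooth_form (form_of_superfun f).
Proof.
move=> sf i j S m; have oV := @open_coord_image i j.
pose h (p : M) : R := if [forall b, rshift r b \notin S] && (m == [ffun=> 0%N])
            then f p [seq frame j p a | a <- enum 'I_r & lshift n a \in S]
            else 0.
apply: (@smooth_fun_eq _ _ _ (h \o cinv i)) => //.
  move=> _ [p ijp <-] /=; rewrite cmapK; last by case: ijp.
  by rewrite /form_of_superfun /patch mem_set.
rewrite /h; case: (_ && _); last exact: smooth_fun_cst.
exact: superfun_smooth.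
Qed.

Lemma partial_xD b w w' : smooth_form w -> smooth_form w' ->
  partial_x b (w + w') = partial_x b w + partial_x b w'.
Proof.
move=> sw sw'; apply: partial_x_ext => i j S m p ijp.
  rewrite -[RHS]/(partial_x b w i j S m p + partial_x b w' i j S m p) !partial_xE//.
  by rewrite -deriveD//; exact: smooth_form_derivable.
by rewrite -[LHS]/(partial_x b w i j S m p + partial_x b w' i j S m p) !partial_x_out// addr0.
Qed.

Lemma partial_x0 b : partial_x b (0 : diff_form E) = 0.
Proof.
apply: partial_x_ext => // i j S m p ijp; rewrite partial_xE//.
exact: derive_cst.
Qed.

Lemma partial_xZ b (k : R) w : smooth_form w ->
  partial_x b (k *: w) = k *: partial_x b w.
Proof.
move=> sw; apply: partial_x_ext => i j S m p ijp.
  rewrite -[RHS]/(k * partial_x b w i j S m p) !partial_xE//.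
  by rewrite -[LHS]/('D__ (k *: (fun x => w i j S m (cinv i x))) _) deriveZ//;
    exact: smooth_form_derivable.
by rewrite -[LHS]/(k * partial_x b w i j S m p) partial_x_out// mulr0.
Qed.

Lemma partial_x_sum b (I : Type) (s : seq I) (F : I -> diff_form E) :
  (forall k, smooth_form (F k)) ->
  partial_x b (\sum_(k <- s) F k) = \sum_(k <- s) partial_x b (F k).
Proof.
move=> sF; elim: s => [|k s IH]; first by rewrite !big_nil partial_x0.
by rewrite !big_cons partial_xD ?IH//; exact: smooth_form_sum.
Qed.

Lemma partial_x_wedge b c w : smooth_form w ->
  partial_x b (wedge c w) = wedge c (partial_x b w).
Proof.
move=> sw; apply: partial_x_ext => i j S m p ijp; rewrite /wedge; last first.
  by rewrite partial_x_out// mulr0; case: ifP.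
rewrite partial_xE//; case: (c \in S); last exact: derive_cst.
rewrite partial_xE// -[LHS]/('D__ (_ *: (fun x => w _ _ _ _ (cinv i x))) _) deriveZ//.
exact: smooth_form_derivable.
Qed.

Lemma partial_x_contr b c w : smooth_form w ->
  partial_x b (contr c w) = contr c (partial_x b w).
Proof.
move=> sw; apply: partial_x_ext => i j S m p ijp; rewrite /contr; last first.
  by rewrite partial_x_out// mulr0; case: ifP.
rewrite partial_xE//; case: (c \in S); first exact: derive_cst.
rewrite partial_xE// -[LHS]/('D__ (_ *: (fun x => w _ _ _ _ (cinv i x))) _) deriveZ//.
exact: smooth_form_derivable.
Qed.

Lemma partial_x_theta b a w : partial_x b (theta a w) = theta a (partial_x b w).
Proof.
apply: partial_x_ext => i j S m p ijp; rewrite /theta; last first.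
  by rewrite partial_x_out//; case: ifP.
by rewrite partial_xE//; case: (0 < m a)%N; [rewrite partial_xE|exact: derive_cst].
Qed.

Lemma partial_x_comm b b' w : smooth_form w ->
  partial_x b (partial_x b' w) = partial_x b' (partial_x b w).
Proof.
move=> sw; have oV i j := @open_coord_image i j.
have P b1 b2 i j S m p : coord_dom i j p -> partial_x b1 (partial_x b2 w) i j S m p
   = 'D_(delta_mx 0 b1) ('D_(delta_mx 0 b2) (fun x => w i j S m (cinv i x))) (cmap i p).
  move=> ijp; rewrite partial_xE//; apply: near_eq_derive.
  have : nbhs (cmap i p) (cmap i @` coord_dom i j)%classic.
    by apply: open_nbhs_nbhs; split=> //; exists p.
  by apply: filterS => _ [q ijq <-]; rewrite cmapK ?partial_xE//; case: ijq.
apply: partial_x_ext => i j S m p ijp; last exact: partial_x_out.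
rewrite (P b b' _ _ _ _ _ ijp) (P b' b _ _ _ _ _ ijp).
by apply: (smooth_fun_derive_comm _ _ (oV i j) (sw i j S m)); exists p.
Qed.

(** The product of forms is a finite sum of products of coefficients, so this is
    the Leibniz rule for [d/dx^b]. *)
Lemma partial_x_mul b w w' : smooth_form w -> smooth_form w' ->
  partial_x b (form_mul w w') =
  form_mul (partial_x b w) w' + form_mul w (partial_x b w').
Proof.
move=> sw sw'; apply: partial_x_ext => i j S m p ijp; last first.
  rewrite -[LHS]/(form_mul _ _ i j S m p + form_mul _ _ i j S m p).
  rewrite /form_mul !big1 ?addr0// => T _; rewrite big1// => m' _.
    by rewrite partial_x_out// mulr0.
  by rewrite partial_x_out// mulr0 mul0r.
rewrite -[RHS]/(form_mul _ _ i j S m p + form_mul _ _ i j S m p) partial_xE//.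
rewrite /form_mul.
set u := delta_mx 0 b; set x0 := cmap i p.
have dsum (I : Type) (s : seq I) (P : pred I) (F : I -> 'rV[R]_n -> R) (dF : I -> R) :
    (forall k, is_derive x0 u (F k) (dF k)) ->
    is_derive x0 u (fun x => \sum_(k <- s | P k) F k x) (\sum_(k <- s | P k) dF k).
  move=> HF; elim: s => [|k s IH].
    rewrite big_nil (_ : (fun _ => _) = cst 0); last by apply/funext => x; rewrite big_nil.
    exact: is_derive_cst.
  rewrite big_cons; case: ifP => Pk.
    rewrite (_ : (fun _ => _) = F k \+ (fun x => \sum_(k <- s | P k) F k x)).
      exact: is_deriveD.
    by apply/funext => x; rewrite big_cons Pk.
  rewrite (_ : (fun _ => _) = (fun x => \sum_(k <- s | P k) F k x))//.
  by apply/funext => x; rewrite big_cons Pk.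
rewrite -big_split /=; apply: (@derive_val _ _ _ _ _ _ _ _); apply: (dsum) => T.
rewrite -big_split /=; apply: dsum => m'.
have d1 := @derivableP _ _ _ _ _ _ (@smooth_form_derivable b w i j T [ffun a => nat_of_ord (m' a)] p sw ijp).
have d2 := @derivableP _ _ _ _ _ _ (@smooth_form_derivable b w' i j (finset.setD S T) [ffun a => (m a - m' a)%N] p sw' ijp).
have := is_deriveM (is_deriveZ ((-1) ^+ inversions T (finset.setD S T)) d1) d2.
move=> H; apply: (@is_derive_eq _ _ _ _ _ _ _ _ H).
rewrite -[X in X *: _ + _]/(_ * w i j T [ffun a => nat_of_ord (m' a)] (cinv i (cmap i p))).
rewrite !(partial_xE _ _ _ _ ijp) /GRing.scale /= cmapK; last by case: ijp.
ring.
Qed.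

End Derivations.

(** * The de Rham differential and the grading *)

Section DeRham.
Import boot.finset.
Context {R : realType} {n : nat} {M : manifold R n} {r : nat}.
Variable E : vector_bundle M r.
Implicit Types (c : 'I_(r + n)) (b : 'I_n) (a : 'I_r).
Implicit Types (m : {ffun 'I_r -> nat}) (w : diff_form E).

Lemma wedge0 c : wedge c 0 = 0 :> diff_form E.
Proof. by apply: form_ext => i j S m p; rewrite /wedge; case: ifP => // _; exact: mulr0. Qed.

Lemma theta0 a : theta a 0 = 0 :> diff_form E.
Proof. by apply: form_ext => i j S m p; rewrite /theta; case: ifP. Qed.

Lemma contr0 c : contr c 0 = 0 :> diff_form E.
Proof. by apply: form_ext => i j S m p; rewrite /contr; case: ifP => // _; exact: mulr0. Qed.

Lemma form_mul0l w : form_mul 0 w = 0.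
Proof.
apply: form_ext => i j S m p; apply: big1 => T _; apply: big1 => m' _.
by rewrite -[X in _ * X * _]/(0 : R) mulr0 mul0r.
Qed.

Lemma form_mul0r w : form_mul w 0 = 0.
Proof.
apply: form_ext => i j S m p; apply: big1 => T _; apply: big1 => m' _; exact: mulr0.
Qed.

(** The de Rham differential as a sum of products of the elementary operators,
    whose commutation relations are known. *)
Lemma deRhamE w : deRham w =
  \sum_b wedge (rshift r b) (partial_x b w) + \sum_a theta a (contr (lshift n a) w).
Proof.
rewrite /deRham; congr (_ + _); apply: eq_bigr => k _.
  by rewrite coord_dxE form_mul_wedgel form_mul1.
by rewrite coord_dxiE form_mul_thetal form_mul1.
Qed.

Lemma smooth_form_deRham w : smooth_form w -> smooth_form (deRham w).
Proof.
move=> sw; rewrite deRhamE; apply: smooth_formD; apply: smooth_form_sum => k.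
  by apply: smooth_form_wedge; exact: smooth_form_partial.
by apply: smooth_form_theta; exact: smooth_form_contr.
Qed.

Lemma deRhamD w w' : smooth_form w -> smooth_form w' ->
  deRham (w + w') = deRham w + deRham w'.
Proof.
move=> sw sw'; rewrite !deRhamE addrACA -!big_split; congr (_ + _).
  by apply: eq_bigr => b _; rewrite partial_xD// wedgeD.
by apply: eq_bigr => a _; rewrite contrD thetaD.
Qed.

Lemma form_sumE (I : Type) (s : seq I) (F : I -> diff_form E) i j S m p :
  (\sum_(k <- s) F k) i j S m p = \sum_(k <- s) F k i j S m p.
Proof.
elim: s => [|k s IH]; first by rewrite !big_nil.
by rewrite !big_cons -IH.
Qed.

Lemma deRhamZ (k : R) w : smooth_form w -> deRham (k *: w) = k *: deRham w.
Proof.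
move=> sw; apply: form_ext => i j S m p.
rewrite -[RHS]/(k * deRham w i j S m p) !deRhamE.
rewrite -[LHS]/((\sum_b _) i j S m p + (\sum_a _) i j S m p).
rewrite -[X in _ = _ * X]/((\sum_b _) i j S m p + (\sum_a _) i j S m p).
rewrite !form_sumE mulrDr !big_distrr; congr (_ + _); apply: eq_bigr => l _.
  by rewrite partial_xZ// wedgeZ.
by rewrite contrZ thetaZ.
Qed.

Lemma thetaN a w : theta a (- w) = - theta a w.
Proof.
apply: form_ext => i j S m p; rewrite -[RHS]/(- theta a w i j S m p) /theta.
by case: ifP => _; rewrite ?oppr0.
Qed.

(** The products [dx dx d/dx d/dx] and [dxi dxi d/dxi d/dxi] are antisymmetric
    in their two indices, and the two kinds of mixed products cancel each
    other. *)
Lemma deRham_deRham w : smooth_form w -> deRham (deRham w) = 0.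
Proof.
move=> sw; have spw b : smooth_form (partial_x b w) by exact: smooth_form_partial.
have scw c : smooth_form (contr c w) by exact: smooth_form_contr.
have stw a : smooth_form (theta a (contr (lshift n a) w)) by exact: smooth_form_theta.
have sww b : smooth_form (wedge (rshift r b) (partial_x b w)) by exact: smooth_form_wedge.
have wsum c (I : finType) (F : I -> diff_form E) :
    wedge c (\sum_k F k) = \sum_k wedge c (F k).
  exact: (big_morph _ (wedgeD c) (wedge0 c)).
have tsum a (I : finType) (F : I -> diff_form E) :
    theta a (\sum_k F k) = \sum_k theta a (F k).
  exact: (big_morph _ (thetaD a) (theta0 a)).
have csum c (I : finType) (F : I -> diff_form E) :
    contr c (\sum_k F k) = \sum_k contr c (F k).
  exact: (big_morph _ (contrD c) (contr0 c)).
pose W b b' := wedge (rshift r b) (wedge (rshift r b') (partial_x b (partial_x b' w))).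
pose X b a := wedge (rshift r b) (theta a (contr (lshift n a) (partial_x b w))).
pose T a a' := theta a (theta a' (contr (lshift n a) (contr (lshift n a') w))).
have Wb b i j S m p : wedge (rshift r b) (partial_x b (deRham w)) i j S m p
    = \sum_b' W b b' i j S m p + \sum_a X b a i j S m p.
  rewrite deRhamE partial_xD ?partial_x_sum//; try exact: smooth_form_sum.
  rewrite wedgeD !wsum -[LHS]/((\sum_b _) i j S m p + (\sum_a _) i j S m p) !form_sumE.
  congr (_ + _); apply: eq_bigr => k _; first by rewrite partial_x_wedge.
  by rewrite partial_x_theta partial_x_contr.
have Ta a i j S m p : theta a (contr (lshift n a) (deRham w)) i j S m p
    = \sum_b - X b a i j S m p + \sum_a' T a a' i j S m p.
  rewrite deRhamE contrD thetaD !csum !tsum.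
  rewrite -[LHS]/((\sum_b _) i j S m p + (\sum_a _) i j S m p) !form_sumE.
  congr (_ + _); apply: eq_bigr => k _; last by rewrite -theta_contr.
  by rewrite contr_wedge ?eq_lrshift// thetaN theta_wedge.
apply: form_ext => i j S m p; rewrite deRhamE.
rewrite -[LHS]/((\sum_b _) i j S m p + (\sum_a _) i j S m p) !form_sumE.
under eq_bigr => b _ do rewrite Wb.
under [X in _ + X]eq_bigr => a _ do rewrite Ta.
rewrite !big_split /= (@sum_antisym R 'I_n (fun b b' => W b b' i j S m p)); last first.
  by move=> b b'; rewrite /W wedge_wedge partial_x_comm.
rewrite (@sum_antisym R 'I_r (fun a a' => T a a' i j S m p)); last first.
  by move=> a a'; rewrite /T theta_theta contr_contr !thetaN.
rewrite add0r addr0 exchange_big -big_split big1//= => a _.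
by rewrite sumrN subrr.
Qed.

(** The Leibniz rule for forms without a degree; the sign is carried by the
    grading involution. *)
Lemma deRham_mul w w' : smooth_form w -> smooth_form w' ->
  deRham (form_mul w w') = form_mul (deRham w) w' + form_mul (parity w) (deRham w').
Proof.
move=> sw sw'.
have mlsum (I : finType) (F : I -> diff_form E) v :
    form_mul (\sum_k F k) v = \sum_k form_mul (F k) v.
  exact: (big_morph (fun u => form_mul u v) (fun u u' => form_mulDl u u' v) (form_mul0l v)).
have mrsum (I : finType) (F : I -> diff_form E) v :
    form_mul v (\sum_k F k) = \sum_k form_mul v (F k).
  exact: (big_morph _ (fun u u' => form_mulDr u u' v) (form_mul0r v)).
rewrite !deRhamE form_mulDl form_mulDr !mlsum !mrsum addrACA -!big_split.
congr (_ + _); apply: eq_bigr => k _ /=.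
  by rewrite partial_x_mul// wedgeD form_mul_wedgel form_mul_wedger parityK.
by rewrite contr_form_mul thetaD form_mul_thetal form_mul_thetar.
Qed.

Definition weight (S : {set 'I_(r + n)}) m : nat := (#|S| + 2 * \sum_a m a)%N.

Lemma homogeneousP (l : nat) w : homogeneous l%:Z w <->
  (forall i j S m p, weight S m != l -> w i j S m p = 0).
Proof.
split=> [hw i j S m p Sl|hw i j S m p w0].
  by apply: contra_neq_eq Sl => /eqP/hw [].
congr Posz; apply/eqP; apply: contra_notT w0; exact: hw.
Qed.

Lemma homogeneousD l w w' : homogeneous l w -> homogeneous l w' ->
  homogeneous l (w + w').
Proof.
move=> hw hw' i j S m p; rewrite -[(w + w') _ _ _ _ _]/(w i j S m p + w' i j S m p).
have [w0|/eqP/hw ->//] := eqVneq (w i j S m p) 0.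
by rewrite w0 add0r; exact: hw'.
Qed.

Lemma homogeneous_sum (I : Type) (s : seq I) (F : I -> diff_form E) (l : nat) :
  (forall k, homogeneous l (F k)) -> homogeneous l (\sum_(k <- s) F k).
Proof.
move=> hF; elim: s => [|k s IH]; first by rewrite big_nil.
by rewrite big_cons; exact: homogeneousD.
Qed.

Lemma homogeneous_mul (k l : nat) w w' :
  homogeneous k w -> homogeneous l w' -> homogeneous (k + l)%N (form_mul w w').
Proof.
move=> /homogeneousP hw /homogeneousP hw'; apply/homogeneousP => i j S m p Skl.
rewrite form_mulE big1// => T TS; rewrite big1_seq// => m' /=.
rewrite mem_below => /forallP le.
have [Tk|/hw->] := eqVneq (weight T m') k; last by rewrite mulr0 mul0r.
rewrite hw' ?mulr0//; apply: contra Skl => /eqP <-; rewrite -Tk /weight.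
rewrite addnACA -mulnDr -big_split /= cardsD; move/setIidPr: (TS) => ->.
rewrite subnKC ?subset_leq_card//; apply/eqP; congr (_ + 2 * _)%N.
by apply: eq_bigr => a _; rewrite ffunE subnKC.
Qed.

Lemma homogeneous_deRham (l : nat) w : homogeneous l w -> homogeneous l.+1 (deRham w).
Proof.
move=> /homogeneousP hw; rewrite deRhamE; apply: homogeneousD; apply: homogeneous_sum => k;
  apply/homogeneousP => i j S m p Sl.
  rewrite /wedge; case: ifP => // kS.
  have w0 q : w i j (S :\ rshift r k) m q = 0.
    apply: hw; apply: contra Sl => /eqP <-.
    by rewrite /weight [in X in X == _](cardsD1 (rshift r k)) kS.
  have [ijp|nijp] := pselect (coord_dom i j p); last by rewrite partial_x_out ?mulr0.
  rewrite partial_xE// (_ : (fun x => _) = cst 0) ?derive_cst ?mulr0//.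
  by apply/funext => x; rewrite w0.
rewrite /theta /contr; case: ifP => // ma; case: ifP => // kS.
rewrite hw ?mulr0//; apply: contra Sl => /eqP <-; rewrite /weight cardsU1 kS.
have Em : (\sum_a m a = (\sum_a mdec k m a).+1)%N.
  rewrite (bigD1 k)//= [in RHS](bigD1 k)//= ffunE eqxx.
  rewrite [X in _ = (_ + X).+1](eq_bigr m) => [|a /negPf ak]; last first.
    by rewrite ffunE ak subn0.
  by rewrite -addSn subn1 prednK.
by rewrite Em; apply/eqP; lia.
Qed.

Lemma parity_homogeneous (l : nat) w : homogeneous l w -> parity w = (-1) ^+ l *: w.
Proof.
move=> /homogeneousP hw; apply: form_ext => i j S m p.
rewrite -[RHS]/(_ * w i j S m p) /parity.
have [<-|/hw ->] := eqVneq (weight S m) l; last by rewrite !mulr0.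
by rewrite /weight exprD exprM sqrrN !expr1n mulr1.
Qed.

Lemma homogeneous_superfun (f : superfun E) (k : nat) :
  (forall p us, size us <> k -> f p us = 0) -> homogeneous k (form_of_superfun f).
Proof.
move=> fk; apply/homogeneousP => i j S m p Sk; rewrite /form_of_superfun /patch.
case: ifP => // _; case: ifP => // /andP[/forallP dS /eqP mE].
apply: fk => sz; move/eqP: Sk; apply; rewrite -sz size_map /weight.
rewrite mE big1 ?muln0 ?addn0 => [|a _]; last by rewrite ffunE.
have ES : S = [set lshift n a | a in [set a | lshift n a \in S]].
  apply/setP => c; apply/idP/imsetP => [cS|[a + ->]]; last by rewrite inE.
  case: (split_ordP c) cS => [a -> aS|b -> bS]; first by exists a; rewrite ?inE.
  by have := dS b; rewrite bS.
rewrite [in LHS]ES card_imset; last exact: lshift_inj.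
rewrite cardE [in LHS]/enum_mem -enumT; congr size.
by apply: eq_filter => a; rewrite /= inE.
Qed.

End DeRham.

(** * Exponential of an even derivation of a graded algebra *)

(** [exp_op] over an arbitrary module. *)
Definition expo {K : numFieldType} {V : lmodType K} (iota : V -> V) (w : V) : V :=
  \sum_(k < xget 0%N [set N | iter N iota w = 0]%classic) (k`!%:R : K)^-1 *: iter k iota w.

(** Here [V] plays the role of all families of coefficients, on which the
    operators need not be linear, and [Om] that of Omega; this is why linearity
    and the Leibniz rules are relative to [Om].  Homogeneity makes sense on all
    of [V]. *)
Section GradedDerivations.
Context {K : numFieldType} {V : lmodType K}.
Implicit Types (v w : V) (k l : nat).
Context (mul : V -> V -> V) (Om : V -> Prop) (hom : nat -> V -> Prop).
Context (Gen : nat -> V -> Prop) (d iota : V -> V).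

(** The homogeneous elements generated by [Gen] and its differentials.  The
    degree must be recorded because the Leibniz rules depend on it. *)
Inductive graded : nat -> V -> Prop :=
| graded_gen k w : Gen k w -> graded k w
| graded_diff k w : Gen k w -> graded k.+1 (d w)
| graded_add k v w : graded k v -> graded k w -> graded k (v + w)
| graded_mul k l v w : graded k v -> graded l w -> graded (k + l) (mul v w).

(** Inducting on sums of homogeneous elements, instead of on Omega itself, keeps
    both factors of a product homogeneous. *)
Inductive graded_span : V -> Prop :=
| span_graded k w : graded k w -> graded_span w
| span_add v w : graded_span v -> graded_span w -> graded_span (v + w).

Definition linear_on (f : V -> V) :=
  forall a v w, Om v -> Om w -> f (a *: v + w) = a *: f v + f w.

Definition odd_derivation (D : V -> V) :=
  forall k v w, Om v -> Om w -> hom k v ->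
    D (mul v w) = mul (D v) w + (-1) ^+ k *: mul v (D w).

Hypothesis mulDl : forall u v w, mul (u + v) w = mul u w + mul v w.
Hypothesis mulDr : forall u v w, mul w (u + v) = mul w u + mul w v.
Hypothesis Om0 : Om 0.
Hypothesis OmD : forall v w, Om v -> Om w -> Om (v + w).
Hypothesis OmZ : forall a v, Om v -> Om (a *: v).
Hypothesis OmM : forall v w, Om v -> Om w -> Om (mul v w).
Hypothesis Om_span : forall w, Om w -> graded_span w.
Hypothesis GenOm : forall k w, Gen k w -> Om w /\ Om (d w).
Hypothesis Gen_hom : forall k w, Gen k w -> hom k w.
Hypothesis homD : forall k v w, hom k v -> hom k w -> hom k (v + w).
Hypothesis homM : forall k l v w, hom k v -> hom l w -> hom (k + l) (mul v w).
Hypothesis homZ : forall k a w, hom k w -> hom k (a *: w).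
Hypothesis hom_d : forall k w, hom k w -> hom k.+1 (d w).
Hypothesis dL : linear_on d.
Hypothesis d_odd : odd_derivation d.
Hypothesis ddOm : forall w, Om w -> d (d w) = 0.
Hypothesis iotaOm : forall w, Om w -> Om (iota w).
Hypothesis iotaL : linear_on iota.
Hypothesis iota_hom : forall k w, Om w -> hom k w -> hom k (iota w).
Hypothesis iota_mul : forall k v w, Om v -> Om w -> hom k v ->
  iota (mul v w) = mul (iota v) w + mul v (iota w).
Hypothesis Gen_iota : forall k f, Gen k f ->
  [/\ iota f = 0, iota (iota (d f)) = 0 & iota (d (iota (d f))) = 0].

Lemma lin0 (f : V -> V) :
  linear_on f -> f 0 = 0.
Proof.
by move=> fL; have := fL (-1) 0 0 Om0 Om0; rewrite scaler0 addr0 scaleN1r addNr.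
Qed.

Lemma linD (f : V -> V) v w :
  linear_on f ->
  Om v -> Om w -> f (v + w) = f v + f w.
Proof. by move=> fL Ov Ow; rewrite -[v in LHS]scale1r fL// scale1r. Qed.

Lemma linZ (f : V -> V) a v :
  linear_on f ->
  Om v -> f (a *: v) = a *: f v.
Proof. by move=> fL Ov; rewrite -[_ *: v]addr0 fL// (lin0 fL) addr0. Qed.

Lemma Om_sum (I : Type) (s : seq I) (F : I -> V) :
  (forall x, Om (F x)) -> Om (\sum_(x <- s) F x).
Proof.
move=> OF; elim: s => [|x s IH]; first by rewrite big_nil.
by rewrite big_cons; exact: OmD.
Qed.

Lemma lin_sum (f : V -> V) (I : Type) (s : seq I) (F : I -> V) :
  linear_on f ->
  (forall x, Om (F x)) -> f (\sum_(x <- s) F x) = \sum_(x <- s) f (F x).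
Proof.
move=> fL OF; elim: s => [|x s IH]; first by rewrite !big_nil (lin0 fL).
by rewrite !big_cons (linD fL) ?IH//; exact: Om_sum.
Qed.

Lemma OmB v w : Om v -> Om w -> Om (v - w).
Proof. by move=> Ov Ow; rewrite -scaleN1r; apply: OmD => //; exact: OmZ. Qed.

Lemma linB (f : V -> V) v w :
  linear_on f ->
  Om v -> Om w -> f (v - w) = f v - f w.
Proof. by move=> fL Ov Ow; rewrite addrC -scaleN1r fL// scaleN1r addrC. Qed.

Lemma iterOm k w : Om w -> Om (iter k iota w).
Proof. by move=> Ow; elim: k => //= k; exact: iotaOm. Qed.

Lemma iterL k a v w : Om v -> Om w ->
  iter k iota (a *: v + w) = a *: iter k iota v + iter k iota w.
Proof. by move=> Ov Ow; elim: k => //= k ->; rewrite iotaL//; exact: iterOm. Qed.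

Lemma iter_killed N k w : Om w -> iter N iota w = 0 -> (N <= k)%N -> iter k iota w = 0.
Proof.
move=> Ow wN /subnK <-; rewrite iterD wN.
by apply: (lin0 (f := iter _ iota)) => *; exact: iterL.
Qed.

Lemma span_mul v w : graded_span v -> graded_span w -> graded_span (mul v w).
Proof.
move=> sv sw; elim: sv => [k {}v gv|v1 v2 _ IH1 _ IH2]; last first.
  by rewrite mulDl; exact: span_add.
elim: sw => [l {}w gw|w1 w2 _ IH1 _ IH2]; last by rewrite mulDr; exact: span_add.
by apply: span_graded; exact: graded_mul gv gw.
Qed.

Lemma graded_Om k w : graded k w -> Om w.
Proof.
elim=> {k w} [k w /GenOm[]|k w /GenOm[]|k v w _ Ov _ Ow|k l v w _ Ov _ Ow] //.
  exact: OmD.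
exact: OmM.
Qed.

Lemma graded_hom k w : graded k w -> hom k w.
Proof.
elim=> {k w} [k w /Gen_hom|k w /Gen_hom /hom_d|k v w _ Ov _ Ow|k l v w _ Ov _ Ow] //.
  exact: homD.
exact: homM.
Qed.

Lemma span_Om w : graded_span w -> Om w.
Proof.
by elim=> [k {}w /graded_Om|v1 v2 _ Ov1 _ Ov2] //; exact: OmD.
Qed.

Lemma Om_ind (P : V -> Prop) : (forall k w, graded k w -> P w) ->
  (forall v w, Om v -> Om w -> P v -> P w -> P (v + w)) ->
  forall w, Om w -> P w.
Proof.
move=> Pg PD w /Om_span; elim=> [k {}w /Pg//|v1 v2 s1 P1 s2 P2].
by apply: PD => //; exact: span_Om.
Qed.

Lemma mulv0l w : mul 0 w = 0.
Proof.
by apply: (@addrI _ (mul 0 w)); rewrite -mulDl !addr0.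
Qed.

Lemma mulv0r w : mul w 0 = 0.
Proof.
by apply: (@addrI _ (mul w 0)); rewrite -mulDr !addr0.
Qed.

(** Stability under [d] can only be seen on homogeneous generators, since the
    Leibniz rule needs the degree of the left factor. *)
Lemma dOm w : Om w -> Om (d w).
Proof.
apply: (@Om_ind (fun w => Om (d w))) => {w} [k w|v w Ov Ow Odv Odw]; last first.
  by rewrite (linD dL)//; exact: OmD.
elim=> {k w} [k w /GenOm[]|k w /GenOm[Ow _]|k v w gv Ov gw Ow|k l v w gv Ov gw Ow] //.
- by rewrite ddOm.
- by rewrite (linD dL)//; [exact: OmD|exact: graded_Om gv|exact: graded_Om gw].
- have Ov' := graded_Om gv; have Ow' := graded_Om gw.
  rewrite (d_odd _ _ (graded_hom gv))//; apply: OmD; first exact: OmM.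
  by apply: OmZ; exact: OmM.
Qed.

(** The commutator of [iota], which is even, with [D]. *)
Definition comm_iota (D : V -> V) w := iota (D w) - D (iota w).

Section CommIota.
Variable D : V -> V.
Hypotheses (DOm : forall w, Om w -> Om (D w)) (DL : linear_on D).

Lemma comm_iota_Om w : Om w -> Om (comm_iota D w).
Proof.
by move=> Ow; apply: OmB; [apply: iotaOm; exact: DOm|apply: DOm; exact: iotaOm].
Qed.

Lemma comm_iota_linear : linear_on (comm_iota D).
Proof.
move=> a v w Ov Ow; have Oiv := iotaOm Ov; have Oiw := iotaOm Ow.
have Odv := DOm Ov; have Odw := DOm Ow.
by rewrite /comm_iota DL// iotaL// iotaL// DL// scalerBr opprD addrACA.
Qed.

Hypothesis D_hom : forall k w, Om w -> hom k w -> hom k.+1 (D w).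

Lemma comm_iota_hom k w : Om w -> hom k w -> hom k.+1 (comm_iota D w).
Proof.
move=> Ow hw; rewrite /comm_iota -scaleN1r; apply: homD.
  by apply: iota_hom; [exact: DOm|exact: D_hom].
by apply: homZ; apply: D_hom; [exact: iotaOm|exact: iota_hom].
Qed.

(** The commutator of an even and an odd derivation is an odd derivation: the
    terms in which [iota] and [D] act on different factors cancel. *)
Lemma comm_iota_odd : odd_derivation D -> odd_derivation (comm_iota D).
Proof.
move=> D_odd k v w Ov Ow hv; have Oiv := iotaOm Ov; have Oiw := iotaOm Ow.
have Odv := DOm Ov; have Odw := DOm Ow.
have mulBl x y z : mul (x - y) z = mul x z - mul y z.
  by apply: (@addIr _ (mul y z)); rewrite subrK -mulDl subrK.
have mulBr x y z : mul z (x - y) = mul z x - mul z y.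
  by apply: (@addIr _ (mul z y)); rewrite subrK -mulDr subrK.
rewrite /comm_iota (D_odd k)// (linD iotaL)//; [|exact: OmM|by apply: OmZ; exact: OmM].
rewrite (linZ _ iotaL); last exact: OmM.
rewrite (iota_mul (k := k.+1))//; last exact: D_hom.
rewrite (iota_mul (k := k))// (iota_mul (k := k))//.
rewrite (linD DL)//; [|exact: OmM|exact: OmM].
rewrite (D_odd k)//; last exact: iota_hom.
rewrite (D_odd k)// mulBl mulBr scalerBr !scalerDr !opprD.
set a1 := mul (iota (D v)) w; set a2 := mul (D v) (iota w).
set a3 := _ *: mul (iota v) (D w); set a4 := _ *: mul v (iota (D w)).
set a5 := mul (D (iota v)) w; set a6 := _ *: mul v (D (iota w)).
rewrite (addrACA (- a5)) (addrACA (a1 + a2)) (addrACA a1) (addrACA a3) !subrr.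
by rewrite addr0 add0r.
Qed.

End CommIota.

Definition lie_iota := comm_iota d.

(** [[iota, [iota, d]]] is a derivation, so it is enough to look at the
    generators and their differentials. *)
Lemma comm_iota_lie w : Om w -> comm_iota lie_iota w = 0.
Proof.
have d_hom k v : Om v -> hom k v -> hom k.+1 (d v) by move=> _; exact: hom_d.
have LO := @comm_iota_Om d dOm; have LL := comm_iota_linear dOm dL.
have lie_odd := comm_iota_odd dOm dL d_hom d_odd.
have lie_hom := comm_iota_hom dOm d_hom.
have Q_odd := comm_iota_odd LO LL lie_hom lie_odd.
have QL := comm_iota_linear LO LL.
have d0 : d 0 = 0 := lin0 dL.
have i0 : iota 0 = 0 := lin0 iotaL.
apply: (@Om_ind (fun w => comm_iota lie_iota w = 0)) => {w} [k w|v w Ov Ow Qv Qw]; last first.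
  by rewrite (linD QL)// Qv Qw addr0.
elim=> {k w} [k w Gw|k w Gw|k v w gv Qv gw Qw|k l v w gv Qv gw Qw].
- have [iw iidw _] := Gen_iota Gw.
  by rewrite /comm_iota /lie_iota /comm_iota iw i0 d0 i0 !subr0 iidw.
- have [iw iidw idid] := Gen_iota Gw; have [Ow _] := GenOm Gw.
  rewrite /comm_iota /lie_iota /comm_iota ddOm// i0 sub0r iidw d0 subr0 idid subr0.
  by rewrite -scaleN1r (linZ _ iotaL) ?idid ?scaler0//; apply: dOm; apply: iotaOm; exact: dOm.
- by rewrite (linD QL) ?Qv ?Qw ?addr0//; [exact: graded_Om gv|exact: graded_Om gw].
- have Ov := graded_Om gv; have Ow := graded_Om gw.
  by rewrite (Q_odd _ _ _ Ov Ow (graded_hom gv)) Qv Qw mulv0l mulv0r scaler0 addr0.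
Qed.

Lemma lie_iota_Om w : Om w -> Om (lie_iota w).
Proof. exact: comm_iota_Om dOm w. Qed.

Lemma lie_iota_linear : linear_on lie_iota.
Proof. exact: comm_iota_linear dOm dL. Qed.

Lemma iota_lie w : Om w -> iota (lie_iota w) = lie_iota (iota w).
Proof. by move=> Ow; apply/eqP; rewrite -subr_eq0; apply/eqP; exact: comm_iota_lie. Qed.

Lemma iter_iota_linear N : linear_on (iter N iota).
Proof. by move=> a v w Ov Ow; exact: iterL. Qed.

(** By the Leibniz rule, applying [iota] to a product lowers one of the two
    exponents by one. *)
Lemma nilpotent_mul N N' k v w : Om v -> Om w -> hom k v ->
  iter N iota v = 0 -> iter N' iota w = 0 -> iter (N + N') iota (mul v w) = 0.
Proof.
(* induction on the sum of the two exponents *)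
have [m] := ubnP (N + N'); elim: m N N' v w => // m IH [|N] N' v w NN' Ov Ow hv.
  by move=> /= -> _; rewrite mulv0l (lin0 (@iter_iota_linear N')).
case: N' NN' => [|N'] NN'.
  by move=> _ /= ->; rewrite mulv0r; exact: (lin0 (@iter_iota_linear (N.+1 + 0))).
have Oiv := iotaOm Ov; have Oiw := iotaOm Ow.
move=> vN wN; rewrite addSn iterSr (iota_mul Ov Ow hv).
rewrite (linD (@iter_iota_linear _)); [|exact: OmM|exact: OmM].
rewrite (IH N N'.+1) ?add0r//; [|exact: iota_hom|by rewrite -iterSr].
rewrite addnS -addSn; apply: IH => //; last by rewrite -iterSr.
by rewrite addSn -addnS.
Qed.

Lemma iota_nilpotent w : Om w -> exists N, iter N iota w = 0.
Proof.
have add u v : Om u -> Om v -> (exists N, iter N iota u = 0) ->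
    (exists N, iter N iota v = 0) -> exists N, iter N iota (u + v) = 0.
  move=> Ou Ov [N uN] [N' vN]; exists (maxn N N').
  rewrite (linD (@iter_iota_linear _))// (iter_killed Ou uN (leq_maxl _ _)).
  by rewrite (iter_killed Ov vN (leq_maxr _ _)) addr0.
move: w; apply: (@Om_ind (fun w => exists N, iter N iota w = 0)); last exact: add.
move=> k w; elim=> {k w} [k w Gw|k w Gw|k v w gv Nv gw Nw|k l v w gv [N Nv] gw [N' Nw]].
- by have [iw _ _] := Gen_iota Gw; exists 1%N.
- by have [_ iidw _] := Gen_iota Gw; exists 2%N.
- exact: add (graded_Om gv) (graded_Om gw) Nv Nw.
- exists (N + N')%N.
  exact: nilpotent_mul (graded_Om gv) (graded_Om gw) (graded_hom gv) Nv Nw.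
Qed.

(** The powers of [iota] that follow a vanishing one vanish too, so any exponent
    killing [w] may serve as the bound of the sum. *)
Lemma expoE N w : Om w -> iter N iota w = 0 ->
  expo iota w = \sum_(k < N) (k`!%:R : K)^-1 *: iter k iota w.
Proof.
move=> Ow wN; rewrite /expo; set N' := xget _ _.
have wN' : iter N' iota w = 0 by apply: (@xgetPex _ 0%N [set N | iter N iota w = 0]%classic); exists N.
pose F k := (k`!%:R : K)^-1 *: iter k iota w.
have H n1 n2 : iter n1 iota w = 0 -> (n1 <= n2)%N -> \sum_(k < n2) F k = \sum_(k < n1) F k.
  move=> w1 n12; rewrite (big_ord_widen _ F n12) [RHS]big_mkcond; apply: eq_bigr => k _.
  case: ltnP => // /(iter_killed Ow w1); rewrite /F => ->; exact: scaler0.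
rewrite -/(\sum_(k < N') F k) -/(\sum_(k < N) F k).
have [NN'|/ltnW NN'] := leqP N N'; first exact: H.
by rewrite (H N').
Qed.

Lemma expoOm w : Om w -> Om (expo iota w).
Proof. by move=> Ow; apply: Om_sum => k; apply: OmZ; exact: iterOm. Qed.

Lemma expoL a v w : Om v -> Om w -> expo iota (a *: v + w) = a *: expo iota v + expo iota w.
Proof.
move=> Ov Ow; have [N vN] := iota_nilpotent Ov; have [N' wN] := iota_nilpotent Ow.
have vm := iter_killed Ov vN (leq_maxl N N').
have wm := iter_killed Ow wN (leq_maxr N N').
have Oavw : Om (a *: v + w) by apply: OmD => //; exact: OmZ.
rewrite !(@expoE (maxn N N'))//; last by rewrite iterL// vm wm scaler0 addr0.
rewrite scaler_sumr -big_split; apply: eq_bigr => k _ /=.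
by rewrite iterL// scalerDr !scalerA mulrC.
Qed.

Lemma expo_fixed w : Om w -> iota w = 0 -> expo iota w = w.
Proof. by move=> Ow w0; rewrite (@expoE 1)// big_ord1 fact0 invr1 scale1r. Qed.

Lemma iota_expo w : Om w -> iota (expo iota w) = expo iota (iota w).
Proof.
move=> Ow; have [N wN] := iota_nilpotent Ow; have Oi := iotaOm Ow.
rewrite (expoE Ow wN) (@expoE N)//; last first.
  by rewrite -iterSr; exact: iter_killed Ow wN (leqnSn N).
rewrite (lin_sum _ iotaL) => [|k]; last by apply: OmZ; exact: iterOm.
apply: eq_bigr => k _; rewrite (linZ _ iotaL) -?iterSr//; exact: iterOm.
Qed.

Lemma iter_expo k w : Om w -> iter k iota (expo iota w) = expo iota (iter k iota w).
Proof. by move=> Ow; elim: k => //= k ->; rewrite iota_expo//; exact: iterOm. Qed.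

(** On the last nonzero power [iota^N w], the exponential is the identity. *)
Lemma expo_eq0 w : Om w -> expo iota w = 0 -> w = 0.
Proof.
move=> Ow ew; have [N] := iota_nilpotent Ow; elim: N => // N IH wN; apply: IH.
rewrite -(expo_fixed (iterOm N Ow) wN) -iter_expo// ew.
by apply: (lin0 (f := iter _ iota)) => *; exact: iterL.
Qed.

Lemma expo_inj v w : Om v -> Om w -> expo iota v = expo iota w -> v = w.
Proof.
move=> Ov Ow evw; apply/eqP; rewrite -subr_eq0; apply/eqP.
apply: expo_eq0; first exact: OmB.
by rewrite (linB expoL)// evw subrr.
Qed.

(** [exp(iota) - 1] lowers the exponent that kills [v], so a preimage of [v] is
    obtained by successive corrections. *)
Lemma expo_surj v : Om v -> exists2 w, Om w & expo iota w = v.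
Proof.
move=> Ov; have [N] := iota_nilpotent Ov; elim: N v Ov => [|N IH] v Ov vN.
  by exists v => //; rewrite expo_fixed// -[v]/(iter 0 iota v) vN (lin0 iotaL).
have Oe := expoOm Ov; have Ou := OmB Ov Oe.
have [|w Ow ew] := IH _ Ou.
  rewrite (linB (f := iter N iota)) => [|a x y Ox Oy||] //; last exact: iterL.
  by rewrite iter_expo// expo_fixed ?subrr//; exact: iterOm.
exists (v + w); first exact: OmD.
by rewrite (linD expoL)// ew addrC subrK.
Qed.

(** [iota] commutes with [L = [iota, d]], so moving [k] copies of [iota] across
    [d] produces [k] copies of [L]. *)
Lemma iter_iota_d k w : Om w ->
  iter k.+1 iota (d w) = d (iter k.+1 iota w) + k.+1%:R *: lie_iota (iter k iota w).
Proof.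
move=> Ow; elim: k => [|k IH]; first by rewrite /= scale1r addrC subrK.
have Oi := iterOm k Ow; have Ol := lie_iota_Om Oi.
rewrite iterS IH (linD iotaL) ?(linZ _ iotaL) ?iota_lie//; last 2 first.
  by apply: dOm; exact: (iterOm k.+1).
  exact: OmZ.
rewrite -[iota (d _)](subrK (d (iota (iter k.+1 iota w)))) addrC -/(lie_iota _).
rewrite (addrC (lie_iota _)) addrCA; congr (_ + _).
by rewrite -[X in _ + X]scale1r -scalerDl natr1.
Qed.

(** Divide [iter_iota_d] by the factorial and sum over [k]. *)
Lemma expo_d w : Om w -> expo iota (d w) = d (expo iota w) + lie_iota (expo iota w).
Proof.
move=> Ow; have [N wN] := iota_nilpotent Ow; have Od := dOm Ow.
have wN1 := iter_killed Ow wN (leqnSn N).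
have dwN : iter N.+1 iota (d w) = 0.
  by rewrite iter_iota_d// wN1 wN (lin0 dL) (lin0 lie_iota_linear) scaler0 addr0.
have OF k : Om ((k`!%:R : K)^-1 *: iter k iota w) by apply: OmZ; exact: iterOm.
rewrite (expoE Od dwN) {1}(expoE Ow wN1) (expoE Ow wN).
rewrite (lin_sum _ dL)// (lin_sum _ lie_iota_linear)// !big_ord_recl -addrA; congr (_ + _).
  by rewrite (linZ _ dL)//.
rewrite -big_split; apply: eq_bigr => k _ /=.
rewrite /bump /= add1n -[iota _]/(iter k.+1 iota (d w)) iter_iota_d//.
rewrite (linZ _ dL) ?(linZ _ lie_iota_linear) ?[LHS]scalerDr; last 2 first.
  exact: iterOm.
  exact: (iterOm k.+1).
by congr (_ + _); rewrite scalerA factS natrM invfM mulrAC mulVf ?mul1r.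
Qed.

(** Since [gammaV] is the inverse of [exp(iota)], the intertwining relation
    [expo_d] applied to [gammaV w] is the conjugation formula. *)
Theorem expo_conjugates_d :
  (forall w, Om w -> exists N, iter N iota w = 0) /\
  exists gammaV : V -> V,
    [/\ forall w, Om w -> Om (expo iota w),
        forall w, Om w -> Om (gammaV w),
        forall w, Om w -> gammaV (expo iota w) = w,
        forall w, Om w -> expo iota (gammaV w) = w
      & forall w, Om w -> Om (d w) /\
          expo iota (d (gammaV w)) = d w + (iota (d w) - d (iota w))].
Proof.
split; first exact: iota_nilpotent.
have inv v : exists w, Om v -> Om w /\ expo iota w = v.
  have [Ov|nOv] := pselect (Om v); last by exists 0.
  by have [w Ow ew] := expo_surj Ov; exists w.
have /choice[gammaV gammaVP] := inv.
have eO w : Om w -> Om (expo iota w) by exact: expoOm.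
exists gammaV; split=> // w Ow.
- by case: (gammaVP w Ow).
- have [Og eg] := gammaVP _ (eO w Ow).
  exact: (expo_inj Og Ow eg).
- by case: (gammaVP w Ow).
- have [Og eg] := gammaVP w Ow; split; first exact: dOm.
  by rewrite expo_d// eg.
Qed.

End GradedDerivations.

(** * The module of forms *)

Section FormModule.
Context {R : realType} {n : nat} {M : manifold R n} {r : nat}.
Variable E : vector_bundle M r.

(** A copy of the type of forms whose module operations are pointwise in the
    coefficients by definition, so that the results on abstract modules apply
    to it without going through iterated function spaces. *)
Definition form_module : Type := diff_form E.
Implicit Types u v w : form_module.

HB.instance Definition _ := gen_eqMixin form_module.
HB.instance Definition _ := gen_choiceMixin form_module.

Definition fm_add v w : form_module := fun i j S m p => v i j S m p + w i j S m p.
Definition fm_zero : form_module := fun i j S m p => 0.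
Definition fm_opp w : form_module := fun i j S m p => - w i j S m p.
Definition fm_scale (a : R) w : form_module := fun i j S m p => a * w i j S m p.

Fact fm_addA : associative fm_add.
Proof. by move=> u v w; apply: form_ext => i j S m p; exact: addrA. Qed.
Fact fm_addC : commutative fm_add.
Proof. by move=> u v; apply: form_ext => i j S m p; exact: addrC. Qed.
Fact fm_add0 : left_id fm_zero fm_add.
Proof. by move=> u; apply: form_ext => i j S m p; exact: add0r. Qed.
Fact fm_addN : left_inverse fm_zero fm_opp fm_add.
Proof. by move=> u; apply: form_ext => i j S m p; exact: addNr. Qed.

HB.instance Definition _ := GRing.isZmodule.Build form_module
  fm_addA fm_addC fm_add0 fm_addN.

Fact fm_scaleA a b v : fm_scale a (fm_scale b v) = fm_scale (a * b) v.
Proof. by apply: form_ext => i j S m p; exact: mulrA. Qed.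
Fact fm_scale1 : left_id 1 fm_scale.
Proof. by move=> u; apply: form_ext => i j S m p; exact: mul1r. Qed.
Fact fm_scaleDr : right_distributive fm_scale +%R.
Proof. by move=> a u v; apply: form_ext => i j S m p; exact: mulrDr. Qed.
Fact fm_scaleDl v : {morph fm_scale^~ v : a b / a + b}.
Proof. by move=> a b; apply: form_ext => i j S m p; exact: mulrDl. Qed.

HB.instance Definition _ := GRing.Zmodule_isLmodule.Build R form_module
  fm_scaleA fm_scale1 fm_scaleDr fm_scaleDl.

Lemma fm_sumE (I : Type) (s : seq I) (F : I -> form_module) i j S m p :
  (\sum_(k <- s) F k : form_module) i j S m p = \sum_(k <- s) F k i j S m p.
Proof.
elim: s => [|k s IH]; first by rewrite !big_nil.
by rewrite !big_cons -IH.
Qed.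

Lemma expoE_exp_op (iota : diff_form E -> diff_form E) w :
  expo (V := form_module) iota w = exp_op iota w.
Proof.
apply: form_ext => i j S m p; rewrite /expo /exp_op fm_sumE.
elim: (index_enum _) => [|k s IH]; first by rewrite !big_nil.
by rewrite !big_cons IH.
Qed.

End FormModule.

(** * Generators of Omega and the theorem *)

Section OmegaTheory.
Context {R : realType} {n : nat} {M : manifold R n} {r : nat}.
Variable E : vector_bundle M r.
Implicit Types (w : diff_form E) (f : superfun E).

Definition superfun_zero : superfun E := fun p us => 0.
Definition superfun_scale (a : R) f : superfun E := fun p us => a * f p us.
Definition superfun_part (k : nat) f : superfun E :=
  fun p us => if size us == k then f p us else 0.

Lemma is_superfun_zero : is_superfun superfun_zero.
Proof.
split=> [p us ws a x y|p us vs ws x|j s]; rewrite /superfun_zero ?mulr0 ?addr0//.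
exact: smooth_on_cst.
Qed.

Lemma is_superfun_scale a f : is_superfun f -> is_superfun (superfun_scale a f).
Proof.
move=> sf; split=> [p us ws b x y|p us vs ws x|j s]; rewrite /superfun_scale.
- by rewrite superfun_linear// mulrDr mulrCA.
- by rewrite superfun_alternating// mulr0.
- apply: smooth_onM; first exact: tdom_open; first exact: smooth_on_cst.
  exact: superfun_smooth.
Qed.

Lemma is_superfun_part k f : is_superfun f -> is_superfun (superfun_part k f).
Proof.
move=> sf; split=> [p us ws b x y|p us vs ws x|j s]; rewrite /superfun_part.
- rewrite !size_cat /=; case: eqP => _; first exact: superfun_linear.
  by rewrite mulr0 addr0.
- by case: eqP => // _; exact: superfun_alternating.
- have -> : (fun p => if size [seq frame j p a | a <- s] == k
      then f p [seq frame j p a | a <- s] else 0) =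
     (if size s == k then fun p => f p [seq frame j p a | a <- s] else fun=> 0).
    by apply/funext => p; rewrite size_map; case: eqP.
  by case: eqP => _; [exact: superfun_smooth|exact: smooth_on_cst].
Qed.

Lemma form_of_zero : form_of_superfun superfun_zero = 0.
Proof.
apply: form_ext => i j S m p; rewrite /form_of_superfun /patch.
by case: ifP => // _; case: ifP.
Qed.

Lemma form_of_scale a f :
  form_of_superfun (superfun_scale a f) = a *: form_of_superfun f.
Proof.
apply: form_ext => i j S m p; rewrite -[RHS]/(a * form_of_superfun f i j S m p).
rewrite /form_of_superfun /patch; case: ifP => _; last by rewrite mulr0.
by case: ifP => _; rewrite ?mulr0.
Qed.

(** A set of odd coordinates has at most [r] elements of the fibre kind, so
    finitely many homogeneous components suffice. *)
Lemma form_of_parts f :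
  form_of_superfun f = \sum_(k < r.+1) form_of_superfun (superfun_part k f).
Proof.
apply: form_ext => i j S m p; rewrite form_sumE /form_of_superfun /patch.
case: ifP => _; last by rewrite big1.
case: ifP => _; last by rewrite big1.
set s := [seq _ | _ <- _]; have sr : (size s < r.+1)%N.
  rewrite ltnS size_map size_filter (leq_trans (count_size _ _))//.
  by rewrite size_enum_ord.
rewrite (bigD1 (Ordinal sr)) //= [X in _ + X]big1 => [|k /negPf kr].
  by rewrite /superfun_part eqxx addr0.
rewrite /superfun_part; case: eqP => // sk; move: kr.
by rewrite -val_eqE /= -sk eqxx.
Qed.

Lemma Omega_smooth w : Omega w -> smooth_form w.
Proof.
elim=> {w} [f sf|f sf|w w' _ sw _ sw'|w w' _ sw _ sw'].
- exact: smooth_form_superfun.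
- by apply: smooth_form_deRham; exact: smooth_form_superfun.
- exact: smooth_formD.
- exact: smooth_form_mul.
Qed.

Lemma Omega0 : Omega (0 : diff_form E).
Proof. by rewrite -form_of_zero; apply: Omega_fun; exact: is_superfun_zero. Qed.

Lemma OmegaZ (a : R) w : Omega w -> Omega (a *: w).
Proof.
elim=> {w} [f sf|f sf|w w' _ sw _ sw'|w w' ow sw ow' sw'].
- by rewrite -form_of_scale; apply: Omega_fun; exact: is_superfun_scale.
- rewrite -deRhamZ; last exact: smooth_form_superfun.
  by rewrite -form_of_scale; apply: Omega_diff; exact: is_superfun_scale.
- rewrite (_ : a *: (w + w') = a *: w + a *: w'); first exact: Omega_add.
  by apply: form_ext => i j S m p; exact: mulrDr.
- by rewrite -form_mulZl; exact: Omega_mul.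
Qed.

Definition function_of_degree (k : nat) w := exists f,
  [/\ is_superfun f, (forall p us, size us <> k -> f p us = 0)
    & w = form_of_superfun f].

Lemma part_degree k f : is_superfun f ->
  function_of_degree k (form_of_superfun (superfun_part k f)).
Proof.
move=> sf; exists (superfun_part k f); split=> //; first exact: is_superfun_part.
by move=> p us; rewrite /superfun_part => /eqP/negPf ->.
Qed.

Notation fspan := (@graded_span R (form_module E) (@form_mul R n M r E)
  function_of_degree (@deRham R n M r E)).

Lemma deRham_sum (F : nat -> diff_form E) N : (forall k, smooth_form (F k)) ->
  deRham (\sum_(k < N.+1) F k) = \sum_(k < N.+1) deRham (F k).
Proof.
move=> sF; elim: N => [|N IH]; first by rewrite !big_ord1.
rewrite big_ord_recr [RHS]big_ord_recr /= -IH deRhamD//; exact: smooth_form_sum.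
Qed.

Lemma span_sum (F : nat -> diff_form E) N :
  (forall k, fspan (F k)) -> fspan (\sum_(k < N.+1) F k : diff_form E).
Proof.
move=> sF; elim: N => [|N IH]; first by rewrite big_ord1.
by rewrite big_ord_recr /=; exact: span_add (IH) (sF _).
Qed.

(** The homogeneous components of a superfunction are superfunctions, and
    products distribute over the sums. *)
Lemma Omega_graded_span w : Omega w -> fspan w.
Proof.
elim=> {w} [f sf|f sf|w w' _ sw _ sw'|w w' _ sw _ sw'].
- rewrite form_of_parts; apply: (@span_sum (fun k => form_of_superfun (superfun_part k f))) => k.
  apply: span_graded; apply: graded_gen; exact: part_degree.
- rewrite form_of_parts (deRham_sum (F := fun k => form_of_superfun (superfun_part k f))).
  apply: (@span_sum (fun k => deRham (form_of_superfun (superfun_part k f)))) => k.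
  by apply: span_graded; apply: graded_diff; exact: part_degree.
  by move=> k; apply: smooth_form_superfun; exact: is_superfun_part.
- exact: span_add.
- exact: (@span_mul R (form_module E) (@form_mul R n M r E) function_of_degree
    (@deRham R n M r E) (@form_mulDl R n M r E) (@form_mulDr R n M r E) _ _ sw sw').
Qed.

End OmegaTheory.

Theorem lemma5p14 (R : realType) (n r : nat) (M : manifold R n)
    (E : vector_bundle M r) (A : lie_algebroid E)
    (dA : superfun E -> superfun E) (iota : diff_form E -> diff_form E)
    (hdA : algebroid_differential A dA) (hiota : interior_product 1 dA iota) :
  (forall w, Omega w -> exists N, iter N iota w = 0) /\
  exists gammaV : diff_form E -> diff_form E,
    [/\ forall w, Omega w -> Omega (exp_op iota w),
        forall w, Omega w -> Omega (gammaV w),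
        forall w, Omega w -> gammaV (exp_op iota w) = w,
        forall w, Omega w -> exp_op iota (gammaV w) = w
      & forall w, Omega w ->
          Omega (deRham w) /\
          exp_op iota (deRham (gammaV w)) = deRham w + lie_derivative 1 iota w].
Proof.
have [[iotaO iotaL iota_deg iota_mul] iota_gen] := hiota.
(* [iota] has degree 0: the sign of its Leibniz rule is 1 *)
have iota_mul' (k : nat) (v w : diff_form E) : Omega v -> Omega w -> homogeneous k%:Z v ->
    iota (form_mul v w) = form_mul (iota v) w + form_mul v (iota w).
  move=> Ov Ow hv; apply: etrans (iota_mul k%:Z v w Ov Ow hv) _.
  have s1 : (-1 : R) ^ ((1 - 1) * k%:Z) = 1 by rewrite subrr mul0r expr0z.
  congr (_ + _); apply: form_ext => i j S m p.
  rewrite -[LHS]/((-1) ^ ((1 - 1) * k%:Z) * form_mul v (iota w) i j S m p).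
  by rewrite s1 mul1r.
have iota_deg' (k : nat) (w : diff_form E) : Omega w -> homogeneous k%:Z w -> homogeneous k%:Z (iota w).
  by move=> Ow hw; have := iota_deg k%:Z w Ow hw; rewrite subrr addr0.
have iota_fun f : is_superfun f -> [/\ iota (form_of_superfun f) = 0,
    iota (iota (deRham (form_of_superfun f))) = 0
    & iota (deRham (iota (deRham (form_of_superfun f)))) = 0].
  move=> sf; have [i0 i1] := iota_gen f sf.
  (* [iota (d f)] is the function [d_A f], whose differential is contracted in
     the same way *)
  have sdf := dA_superfun hdA sf; have [j0 j1] := iota_gen _ sdf.
  rewrite i0 i1 j0 j1; split=> //.
  apply: form_ext => i j S m p; rewrite /form_of_superfun /patch.
  case: ifPn => // /set_mem [ip jp]; case: ifP => // _.
  exact: (dA_dA_frame hdA).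
have d_odd (k : nat) (v w : diff_form E) : Omega v -> Omega w -> homogeneous k%:Z v ->
    deRham (form_mul v w) = form_mul (deRham v) w + (-1 : R) ^+ k *: form_mul v (deRham w).
  move=> Ov Ow hv; rewrite deRham_mul; [|exact: Omega_smooth|exact: Omega_smooth].
  by rewrite (parity_homogeneous hv) form_mulZl.
have dL (a : R) (v w : diff_form E) : Omega v -> Omega w ->
      deRham ((a *: v : diff_form E) + w) = (a *: deRham v : diff_form E) + deRham w.
  move=> Ov Ow; have sv := Omega_smooth Ov; have sw := Omega_smooth Ow.
  by rewrite (deRhamD (smooth_formZ a sv) sw) (deRhamZ a sv).
have Om_d (k : nat) (w : diff_form E) : function_of_degree k w -> Omega w /\ Omega (deRham w).
  by move=> [f [sf _ ->]]; split; [exact: Omega_fun|exact: Omega_diff].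
have Gen_hom (k : nat) (w : diff_form E) : function_of_degree k w -> homogeneous k%:Z w.
  by move=> [f [_ fk ->]]; exact: homogeneous_superfun.
have Gen_iota (k : nat) (w : diff_form E) : function_of_degree k w ->
    [/\ iota w = 0, iota (iota (deRham w)) = 0 & iota (deRham (iota (deRham w))) = 0].
  by move=> [f [sf _ ->]]; exact: iota_fun.
have homZ (k : nat) (a : R) (w : diff_form E) : homogeneous k%:Z w -> homogeneous k%:Z (a *: w).
  move=> /homogeneousP hw; apply/homogeneousP => i j S m p Sk.
  by rewrite -[LHS]/(a * w i j S m p) hw// mulr0.
have ddO (w : diff_form E) : Omega w -> deRham (deRham w) = 0.
  by move=> Ow; apply: deRham_deRham; exact: Omega_smooth.
have [nil [g [g1 g2 g3 g4 g5]]] := @expo_conjugates_d R (form_module E)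
  (@form_mul R n M r E) (@Omega R n M r E)
  (fun k w => homogeneous k%:Z w) (@function_of_degree R n M r E) (@deRham R n M r E) iota
  (@form_mulDl R n M r E) (@form_mulDr R n M r E) (Omega0 E) (@Omega_add R n M r E)
  (@OmegaZ R n M r E) (@Omega_mul R n M r E) (@Omega_graded_span R n M r E) Om_d Gen_hom
  (fun k v w => @homogeneousD R n M r E k v w)
  (@homogeneous_mul R n M r E) homZ
  (@homogeneous_deRham R n M r E) dL d_odd ddO iotaO iotaL iota_deg' iota_mul' Gen_iota.
split; first exact: nil.
exists g; split=> w Ow.
- by rewrite -expoE_exp_op; exact: g1.
- exact: g2.
- by rewrite -expoE_exp_op; exact: g3.
- by rewrite -expoE_exp_op; exact: g4.
- have [Od ed] := g5 w Ow; split=> //; rewrite -expoE_exp_op; apply: etrans ed _.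
  have s1 : (-1 : R) ^ (1 - 1 : int) = 1 by rewrite subrr expr0z.
  apply: form_ext => i j S m p.
  rewrite -[RHS]/(deRham w i j S m p + (iota (deRham w) i j S m p
    - (-1) ^ (1 - 1) * deRham (iota w) i j S m p)).
  by rewrite s1 mul1r.
Qed.
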